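(* For every $s\in(0,1]$, there exist a spectral random measure $\mu$ on $(\mathbb{R},\mathcal{B}(\mathbb{R}))$ with respect to $(\Omega,\mathcal{F})$ and a Bernoulli probability measure $\mathbb{P}$ on $\Omega$ such that $$\dim_{\mathrm H}\mu(\boldsymbol{\omega})=\dim_{\mathrm P}\mu(\boldsymbol{\omega})=s$$ for $\mathbb{P}$-a.e. $\boldsymbol{\omega}\in\Omega$.
   Context: $\Omega=\mathbb{N}^{\mathbb{N}}$ with $\mathbb{N}=\{1,2,3,\dots\}$ is the set of infinite sequences $\boldsymbol{\omega}=\omega_1\omega_2\cdots$ of positive integers, with the metric $d(\boldsymbol{\alpha},\boldsymbol{\beta})=2^{-|\boldsymbol{\alpha}\wedge\boldsymbol{\beta}|}$, where $|\boldsymbol{\alpha}\wedge\boldsymbol{\beta}|$ is the length of the maximal common initial segment ($d=0$ if the sequences are equal). $\mathcal{F}$ is the Borel $\sigma$-algebra of $\Omega$; $\mathcal{B}(\mathbb{R})$ is the Borel $\sigma$-algebra of $\mathbb{R}$. Bernoulli measure: given a probability vector $\mathbf{p}=(p_1,p_2,\dots)$ ($p_j\ge0$, $\sum_{j\ge1}p_j=1$), the associated Bernoulli measure $\mathbb{P}$ is the Borel probability measure on $\Omega$ with $\mathbb{P}(\{\boldsymbol{\omega}:\omega_1=\alpha_1,\dots,\omega_k=\alpha_k\})=p_{\alpha_1}\cdots p_{\alpha_k}$ for all finite words $\alpha_1\cdots\alpha_k$. A mapping $M:\Omega\times\mathcal{B}(\mathbb{R})\to[0,+\infty]$ is a random measure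 on $(\mathbb{R},\mathcal{B}(\mathbb{R}))$ with respect to $(\Omega,\mathcal{F})$ if $\boldsymbol{\omega}\mapsto M(\boldsymbol{\omega},A)$ is $\mathcal{F}$-measurable for every $A\in\mathcal{B}(\mathbb{R})$ and $M(\boldsymbol{\omega})=M(\boldsymbol{\omega},\cdot)$ is a measure for every $\boldsymbol{\omega}\in\Omega$. A Borel probability measure $\nu$ on $\mathbb{R}$ is a spectral measure if there is $\Lambda\subset\mathbb{R}$ such that $\{e^{2\pi i\lambda x}:\lambda\in\Lambda\}$ is an orthonormal basis of $L^2(\nu)$. A random measure $M$ is a spectral random measure if $M(\boldsymbol{\omega})$ is a spectral measure for all $\boldsymbol{\omega}\in\Omega$. For a Borel probability measure $\nu$ on $\mathbb{R}$, $\dim_{\mathrm H}\nu=\inf\{\dim_{\mathrm H}E: E \text{ Borel},\ \nu(E)>0\}$ and $\dim_{\mathrm P}\nu=\inf\{\dim_{\mathrm P}E: E\text{ Borel},\ \nu(E)>0\}$, where $\dim_{\mathrm H}E$ and $\dim_{\mathrm P}E$ are the Hausdorff and packing dimensions of the set $E$. *)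

(* Defs.v *)
From HB Require Import structures.
From mathcomp Require Import all_boot all_order all_algebra.
From mathcomp Require Import all_classical all_reals all_analysis.
From mathcomp Require Import complex.

Set Implicit Arguments.
Unset Strict Implicit.
Unset Printing Implicit Defensive.

Import Order.TTheory GRing.Theory Num.Theory.
Import numFieldNormedType.Exports.

Local Open Scope classical_set_scope.
Local Open Scope ring_scope.
Local Open Scope complex_scope.

Definition posnat : Type := {n : nat | (0 < n)%N}.

(* [w i] is the letter usually written $\omega_{i+1}$. The parameter [R] only
   fixes the real numbers in which the metric takes its values. *)
Definition Omega (R : realType) : Type := nat -> posnat.

HB.instance Definition _ (R : realType) := gen_eqMixin (Omega R).
HB.instance Definition _ (R : realType) := gen_choiceMixin (Omega R).
HB.instance Definition _ (R : realType) :=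
  isPointed.Build (Omega R) (fun=> exist _ 1%N isT).

(* [ex_minn h] is the first index at which the two sequences differ, that is,
   the length of their longest common initial segment. *)
Definition omega_dist (R : realType) (a b : Omega R) : R :=
  if pselect (exists n, a n != b n) is left h then 2 ^- (ex_minn h) else 0.

Section omega_metric.
Context (R : realType).
Implicit Types a b c : Omega R.

Lemma omega_distxx a : omega_dist a a = 0.
Proof.
by rewrite /omega_dist; case: pselect => // -[n h]; exfalso; rewrite eqxx in h.
Qed.

Lemma omega_dist_le a b n :
  (omega_dist a b <= 2 ^- n) <-> (forall i, (i < n)%N -> a i = b i).
Proof.
rewrite /omega_dist; case: pselect => [h|h].
  case: ex_minnP => m am minm; split.
    rewrite lef_pV2 ?posrE ?exprn_gt0// ler_eXn2l ?ltr1n// => nm i ni.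
    apply/eqP/negPn/negP => /minm; rewrite leqNgt => /negP; apply.
    exact: leq_trans nm.
  move=> ab; rewrite lef_pV2 ?posrE ?exprn_gt0// ler_eXn2l ?ltr1n//.
  by rewrite leqNgt; apply/negP => /ab e; rewrite e eqxx in am.
split=> [_ i _|_]; last by rewrite invr_ge0 exprn_ge0.
by apply/eqP/negPn/negP => abi; apply: h; exists i.
Qed.

Lemma omega_dist_val a b : a = b \/ exists n, omega_dist a b = 2 ^- n.
Proof.
rewrite /omega_dist; case: pselect => [h|h]; first by right; exists (ex_minn h).
by left; apply/funext => i; apply/eqP/negPn/negP => abi; apply: h; exists i.
Qed.

Lemma omega_dist_eq0 a b : omega_dist a b = 0 -> a = b.
Proof.
case: (omega_dist_val a b) => // -[n ->] /eqP.
by rewrite invr_eq0 expf_eq0/= pnatr_eq0 andbF.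
Qed.

Lemma omega_dist_sym a b : omega_dist a b = omega_dist b a.
Proof.
suff H (x y : Omega R) : omega_dist x y <= omega_dist y x by apply/le_anti; rewrite !H.
have [<-//|[n e]] := omega_dist_val y x.
rewrite e; apply/omega_dist_le => i ni.
by have /omega_dist_le/(_ i ni) : omega_dist y x <= 2 ^- n by rewrite e.
Qed.

Lemma omega_dist_ge0 a b : 0 <= omega_dist a b.
Proof.
have [->|[n ->]] := omega_dist_val a b; first by rewrite omega_distxx.
by rewrite invr_ge0 exprn_ge0.
Qed.

Lemma omega_dist_ultra b a c :
  omega_dist a c <= Num.max (omega_dist a b) (omega_dist b c).
Proof.
have [->|[n en]] := omega_dist_val a b; first by rewrite le_max lexx orbT.
have [<-|[m em]] := omega_dist_val b c; first by rewrite le_max lexx.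
have H k : omega_dist a b <= 2 ^- k -> omega_dist b c <= 2 ^- k ->
    omega_dist a c <= 2 ^- k.
  move=> /omega_dist_le ab /omega_dist_le bc.
  by apply/omega_dist_le => i ik; rewrite ab// bc.
case: (leP (omega_dist a b) (omega_dist b c)) => [|/ltW] le.
  by rewrite em; apply: H; rewrite -?em.
by rewrite en; apply: H; rewrite -?en.
Qed.

Lemma omega_dist_triangle b a c :
  omega_dist a c <= omega_dist a b + omega_dist b c.
Proof.
apply: le_trans (omega_dist_ultra b a c) _.
by rewrite ge_max lerDl lerDr !omega_dist_ge0.
Qed.

HB.instance Definition _ := @isMetric.Build R (Omega R) (@omega_dist R)
  omega_distxx omega_dist_eq0 omega_dist_sym omega_dist_triangle.

End omega_metric.

Definition OmegaF (R : realType) := g_sigma_algebraType (@open (Omega R)).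

(* The value [p 0] plays no role. *)
Definition prob_vector (R : realType) (p : nat -> R) : Prop :=
  (forall j, (1 <= j)%N -> 0 <= p j) /\ (\sum_(1 <= j <oo) (p j)%:E = 1)%E.

Definition cylinder (R : realType) (u : seq posnat) : set (OmegaF R) :=
  [set w : OmegaF R | forall i : 'I_(size u), w i = tnth (in_tuple u) i].

Definition bernoulli_measure (R : realType) (P : probability (OmegaF R) R) :
    Prop :=
  exists p : nat -> R, prob_vector p /\
    forall u : seq posnat, P (@cylinder R u) = (\prod_(a <- u) p (val a))%:E.

Section spectral.
Context (R : realType) (nu : {measure set R -> \bar R}).

Definition L2norm (f : R -> R[i]) : \bar R :=
  ('N[nu]_2%:E[EFin \o (@Normc.normc R \o f)])%E.

Definition inL2 (f : R -> R[i]) : Prop :=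
  [/\ measurable_fun setT (fun x => complex.Re (f x)),
      measurable_fun setT (fun x => complex.Im (f x)) &
      (L2norm f < +oo)%E].

Definition L2inner (f g : R -> R[i]) : R[i] :=
  (\int[nu]_x complex.Re (f x * (g x)^*)) +i*
  (\int[nu]_x complex.Im (f x * (g x)^*)).

Definition orthonormal_family (I : choiceType) (L : set I)
    (e : I -> R -> R[i]) : Prop :=
  (forall i, L i -> inL2 (e i)) /\
  (forall i j, L i -> L j -> L2inner (e i) (e j) = (i == j)%:R).

(* The linear span of the family is dense in $L^2(\nu; \mathbb C)$. *)
Definition L2total (I : choiceType) (L : set I) (e : I -> R -> R[i]) : Prop :=
  forall f, inL2 f -> forall eps : R, 0 < eps ->
  exists (s : seq I) (c : I -> R[i]), (forall i, i \in s -> L i) /\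
    (L2norm (fun x => f x - \sum_(i <- s) c i * e i x)%R < eps%:E)%E.

Definition orthonormal_basis (I : choiceType) (L : set I)
    (e : I -> R -> R[i]) : Prop :=
  orthonormal_family L e /\ L2total L e.

(* $x \mapsto e^{2\pi i\lambda x}$ *)
Definition exponential (l x : R) : R[i] :=
  cos (2 * pi * l * x) +i* sin (2 * pi * l * x).

Definition spectral_measure : Prop :=
  nu setT = 1%E /\ exists L : set R, orthonormal_basis L exponential.

End spectral.

(* A random measure on $\mathbb R$ with respect to $(\Omega, \mathcal F)$ is
   precisely a kernel from [OmegaF R] to [R]. *)
Definition spectral_random_measure (R : realType) (M : R.-ker OmegaF R ~> R) :
    Prop :=
  forall w : OmegaF R, spectral_measure (M w).

Section dimension.
Context (R : realType).
Implicit Types (E U : set R) (s delta : R).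

(* The supremum of the empty set is [-oo], hence the extra point [0]. *)
Definition diameter U : \bar R :=
  ereal_sup ([set 0%E] `|` [set (`|x - y|)%:E | x in U & y in U]).

(* $|U|^s$, with $0^0 = 1$ for nonempty [U] and $|\emptyset|^s = 0$ for all
   $s$, including $s = 0$. *)
Definition diam_pow s U : \bar R :=
  if U == set0 then 0%E else (diameter U `^ s)%E.

Definition hausdorff_pre s delta E : \bar R :=
  ereal_inf [set (\sum_(n <oo) diam_pow s (U n))%E | U in
    [set U : nat -> set R |
      (forall n, (diameter (U n) <= delta%:E)%E) /\ E `<=` \bigcup_n U n]].

Definition hausdorff_measure s E : \bar R :=
  ereal_sup [set hausdorff_pre s delta E | delta in [set delta | 0 < delta]].

Definition dimH E : \bar R :=
  ereal_inf [set s%:E | s in [set s | 0 <= s /\ hausdorff_measure s E = 0%E]].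

(* [D] may be finite or infinite, so that both finite and countably infinite
   packings are covered. *)
Definition packing delta E (D : set nat) (x r : nat -> R) : Prop :=
  (forall n, D n -> [/\ E (x n), 0 < r n & r n <= delta]) /\
  trivIset D (fun n => closed_ball (x n) (r n)).

Definition packing_pre_delta s delta E : \bar R :=
  ereal_sup [set l | exists D x r, packing delta E D x r /\
    l = \esum_(n in D) diam_pow s (closed_ball (x n) (r n))].

Definition packing_pre s E : \bar R :=
  ereal_inf [set packing_pre_delta s delta E | delta in [set delta | 0 < delta]].

(* The packing premeasure is not countably subadditive, whence the infimum over
   countable covers. *)
Definition packing_measure s E : \bar R :=
  ereal_inf [set (\sum_(n <oo) packing_pre s (F n))%E | F in
    [set F : nat -> set R | E `<=` \bigcup_n F n]].

Definition dimP E : \bar R :=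
  ereal_inf [set s%:E | s in [set s | 0 <= s /\ packing_measure s E = 0%E]].

Definition dimH_measure (nu : {measure set R -> \bar R}) : \bar R :=
  ereal_inf [set dimH E | E in [set E | measurable E /\ (0 < nu E)%E]].

Definition dimP_measure (nu : {measure set R -> \bar R}) : \bar R :=
  ereal_inf [set dimP E | E in [set E | measurable E /\ (0 < nu E)%E]].

End dimension.

(* Main.v *)
From HB Require Import structures.
Require Import Defs.
From mathcomp Require Import all_boot all_order all_algebra.
From mathcomp Require Import all_classical all_reals all_analysis.
From mathcomp Require Import measurable_realfun complex ring lra zify.
Import Order.TTheory GRing.Theory Num.Theory.
Import numFieldNormedType.Exports.
Local Open Scope classical_set_scope.
Local Open Scope ring_scope.
Set Implicit Arguments.
Unset Strict Implicit.
Unset Printing Implicit Defensive.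

(** The random measure is taken constant, and the Bernoulli measure is the point
    mass at the sequence 111..., that of the probability vector (1, 0, 0, ...).
    What remains is to find one spectral measure whose Hausdorff and packing
    dimensions are both [s].

    Let [e] be a strictly increasing sequence of integers. The measure is the
    law of the random series whose [n]-th term is [2 ^- (e n).+1] times the
    [n]-th of a sequence of independent fair bits, that is, of a random real
    number whose binary digits vanish outside of the places [(e n).+1]. It is
    realised as the image of Lebesgue measure on [0, 1[ under the map [spread],
    which moves the [n]-th binary digit to the place [(e n).+1]. The sequence is
    [e n = trunc (n / s) + (log n)^2], with the integer part of the binary
    logarithm of [n + 1]: the main term gives the dimension, and the squared
    logarithm creates arbitrarily long gaps without changing the density.

    Dimension. The first [n] bits cut the measure into [2 ^ n] pieces of mass
    [2 ^- n] lying in intervals of length about [2 ^- (e n)], and [e n] is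
    equivalent to [n / s]. For [t < s] this gives
    [|x - y| <= C |spread x - spread y| ^ t]
    ([spread_inverse_hoelder]), so the mass of a set is at most a constant times
    its [t]-dimensional Hausdorff measure ([hausdorff_measure_eq0_null]). For
    [t > s] a small ball of radius [r] centred in [carrier] has mass much larger
    than [r ^ t], so a packing by small balls has a small [t]-sum
    ([packing_pre_carrier]). The inequality [dimH_le_dimP] between the two
    dimensions gives the two missing bounds.

    Spectrality. The frequencies are the finite sums of distinct powers
    [2 ^ e i]. The exponentials of the first [2 ^ n] frequencies, evaluated at
    the [2 ^ n] partial sums of the random series (the nodes), form a complex
    Hadamard matrix, because [2 ^ e i] times the [i]-th weight is one half while
    its product with an earlier weight is an integer. The orthogonality of the
    rows ([trig_parseval]) yields an orthonormal family, and the surjectivity of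
    the matrix ([trig_interpolation]) produces exponential sums with prescribed
    values at the nodes. Completeness is where the long gaps enter: when
    [e n.+1] is far above [e n], the part of the series after its [n]-th term
    is negligible compared to the wavelengths of the first [2 ^ n.+1]
    exponentials, so that an exponential sum interpolating a continuous function
    at the nodes stays close to it in the mean ([trig_dense_continuous]). *)

(** * Places of the binary digits *)

Lemma cube_le_pow2 L : (L ^ 3 <= 8 * 2 ^ L)%N.
Proof.
have H k : ((k + 4) ^ 3 <= 8 * 2 ^ (k + 4))%N.
  elim: k => [//|k IH]; rewrite addSn [X in (_ <= 8 * X)%N]expnS mulnCA.
  apply: leq_trans (leq_mul (leqnn 2) IH).
  by rewrite !expnS expn0; nia.
case: (ltnP L 4) => [|L4]; first by case: L => [//|[//|[//|[//|//]]]].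
by rewrite -(subnK L4).
Qed.

(** The squared logarithm is eventually below any linear function; the
    constant absorbs the logarithms smaller than [8 * N], above which
    [N * L ^ 2 <= L ^ 3 / 8 <= 2 ^ L]. *)
Lemma trunc_log_sqr_sublinear N m :
  (N * trunc_log 2 m.+1 ^ 2 <= m.+1 + 64 * N ^ 3)%N.
Proof.
set L := trunc_log 2 m.+1.
have Lm : (2 ^ L <= m.+1)%N by exact: trunc_logP.
have := cube_le_pow2 L; rewrite !expnS expn0 => L3.
case: (leqP (8 * N) L) => NL; first by nia.
have : (N * (L * L) <= N * (8 * N * (8 * N)))%N.
  by rewrite leq_mul2l leq_mul ?orbT// ltnW.
rewrite expn0; nia.
Qed.

Section exponents.
Context {R : realType}.
Variable s : R.
Hypotheses (s_gt0 : 0 < s) (s_le1 : s <= 1).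

(** The increments of the first term are about [1 / s]; those of the second
    vanish except when [n.+2] is a power of two, where they are large. *)
Definition place (n : nat) : nat :=
  (Num.trunc (n%:R / s) + trunc_log 2 n.+1 ^ 2)%N.

Let sV1 : 1 <= s^-1. Proof. by rewrite invf_ge1. Qed.

Let ns_ge0 n : 0 <= n%:R / s. Proof. by rewrite divr_ge0// ltW. Qed.

Lemma place_incr n : (place n < place n.+1)%N.
Proof.
rewrite /place -addSn leq_add//; last by rewrite leq_sqr leq_trunc_log.
rewrite truncn_ge_nat// -addn1 natrD [X in _ <= X](_ : _ = n%:R / s + s^-1).
  by rewrite lerD// truncn_le.
by rewrite -addn1 natrD mulrDl mul1r.
Qed.

(** At [n = 2 ^ N.+1 - 2] the logarithm jumps from [N] to [N.+1], and its
    square by [2 * N + 1]. *)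
Lemma place_gap N : exists2 n, (N <= n)%N & (place n + N <= place n.+1)%N.
Proof.
have N1 : (N < 2 ^ N.+1)%N by rewrite (leq_trans (ltn_expl _ (ltnSn 1)))// leq_exp2l.
have N2 : (N < 2 ^ N)%N by exact: ltn_expl.
exists (2 ^ N.+1 - 2)%N; first by rewrite expnS; nia.
have E1 : trunc_log 2 (2 ^ N.+1 - 2).+1 = N.
  by apply: trunc_log_eq => //; rewrite expnS; apply/andP; split; lia.
have E2 : trunc_log 2 (2 ^ N.+1 - 2).+2 = N.+1.
  by apply: trunc_log_eq => //; rewrite !expnS; apply/andP; split; lia.
rewrite /place E1 E2 -addnA leq_add//; last by rewrite !expnS !expn0; nia.
by rewrite le_truncn// ler_pM2r ?invr_gt0// ler_nat.
Qed.

Lemma place_ge n : n%:R / s < (place n).+1%:R.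
Proof.
by apply: lt_le_trans (truncnS_gt _) _; rewrite ler_nat ltnS leq_addr.
Qed.

Lemma place_le (k : R) : 0 < k ->
  exists C : R, forall n, (place n).+1%:R <= n%:R / s + k * n%:R + C.
Proof.
move=> k0; pose N := (Num.trunc k^-1).+1.
have Nk : 1 <= N%:R * k.
  by rewrite -ler_pdivrMr// div1r ltW// truncnS_gt.
exists (1 + k * (1 + 64 * N%:R ^+ 3)) => n.
have H1 : (Num.trunc (n%:R / s))%:R <= n%:R / s by rewrite truncn_le.
rewrite /place -addn1 !natrD natrX.
have := trunc_log_sqr_sublinear N n; set L := trunc_log _ _.
rewrite -(ler_nat R) natrD (natrM _ N) (natrM _ 64) !natrX => H2.
have L0 : 0 <= L%:R ^+ 2 :> R by rewrite exprn_ge0.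
have : L%:R ^+ 2 <= k * (n%:R + 1 + 64 * N%:R ^+ 3).
  rewrite natr1; apply: le_trans (_ : (N%:R * k) * L%:R ^+ 2 <= _).
    by rewrite ler_peMl.
  by rewrite mulrAC mulrC ler_wpM2l// ltW.
by lra.
Qed.

End exponents.

Section weight_decay.
Context {R : realType}.

Definition weight (e : nat -> nat) (n : nat) : R := 2 ^- (e n).+1.

Lemma weight_gt0 e n : 0 < weight e n.
Proof. by rewrite invr_gt0 exprn_gt0. Qed.

Lemma expr_half_powR (k : nat) : 2 ^- k = 2 `^ (- k%:R) :> R.
Proof. by rewrite powRN powR_mulrn. Qed.

Lemma weight_powR e n t : weight e n `^ t = 2 `^ (- ((e n).+1%:R * t)).
Proof. by rewrite /weight expr_half_powR -powRrM mulNr. Qed.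

Variable s : R.
Hypothesis s_gt0 : 0 < s.

(** Since [t < s], the difference between [m] and [t] times the place of the
    [m]-th digit is a positive multiple of [m] up to an error that is sublinear,
    hence bounded below. *)
Lemma weight_place_lower t : 0 <= t < s ->
  exists2 C : R, 0 < C & forall m, 2 ^- m <= C * weight (place s) m `^ t.
Proof.
move=> /andP[t0 ts].
have [->|tn0] := eqVneq t 0.
  exists 1 => // m; rewrite powRr0 mulr1 invf_le1 ?exprn_gt0//.
  by rewrite exprn_ege1// ler1n.
have {tn0}t_gt0 : 0 < t by rewrite lt_neqAle eq_sym tn0.
have k0 : 0 < t^-1 - s^-1 by rewrite subr_gt0 ltf_pV2.
have [C HC] := place_le s_gt0 k0.
exists (2 `^ (C * t)); first by rewrite powR_gt0.
move=> m; rewrite weight_powR expr_half_powR -powRD; last by apply/implyP.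
apply: ler_powR; first by rewrite ler1n.
have := ler_wpM2r t0 (HC m).
have -> : (m%:R / s + (t^-1 - s^-1) * m%:R + C) * t = m%:R + C * t.
  by field; rewrite !gt_eqF.
lra.
Qed.

(** The factor 4 leaves room for comparing the diameter of a ball of radius
    less than [2 * weight _ m] with the weight itself. *)
Lemma weight_place_upper t : s < t -> forall eps : R, 0 < eps ->
  exists M, forall m, (M <= m)%N ->
    (4 * weight (place s) m) `^ t <= eps * 2 ^- m.+1.
Proof.
move=> st eps eps0; have t0 : 0 < t by exact: lt_trans st.
pose q : R := 2 `^ (1 - t / s).
have q1 : `|q| < 1.
  rewrite ger0_norm ?powR_ge0// /q /powR pnatr_eq0/= expR_lt1.
  by rewrite nmulr_rlt0 ?ln_gt0 ?ltr1n// subr_lt0 ltr_pdivlMr// mul1r.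
have /cvgrPdist_lt/(_ _ eps0)[M _ HM] := cvg_geometric (2 `^ (2 * t + 1)) q1.
exists M => m /HM /=; rewrite sub0r normrN /geometric /=.
rewrite ger0_norm; last by rewrite mulr_ge0// ?exprn_ge0// powR_ge0.
move=> /ltW H; apply: le_trans (ler_wpM2r _ H); last by rewrite invr_ge0 exprn_ge0.
rewrite -powR_mulrn ?powR_ge0// /q -powRrM expr_half_powR.
rewrite -!powRD; try by apply/implyP.
rewrite powRM// ?(ltW (weight_gt0 _ _))//.
have -> : 4 `^ t = 2 `^ (2 * t) :> R.
  by rewrite powRrM powR_mulrn// expr2 -natrM.
rewrite weight_powR -powRD; last by apply/implyP.
apply: ler_powR; first by rewrite ler1n.
have := ler_wpM2r (ltW t0) (ltW (place_ge s m)).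
rewrite -natr1 mulrAC; lra.
Qed.

End weight_decay.

(** * The digit-spreading map *)

Section digit_map.
Context {R : realType}.

(** The [i]-th binary digit, as a difference of integer parts; this form makes
    the integer parts telescope. *)
Definition digit (i : nat) (x : R) : R :=
  (Num.floor (2 ^+ i.+1 * x))%:~R - 2 * (Num.floor (2 ^+ i * x))%:~R.

Lemma digit_itv i x : 0 <= digit i x <= 1.
Proof.
rewrite /digit; set y := 2 ^+ i * x.
have -> : 2 ^+ i.+1 * x = 2 * y by rewrite exprS mulrA.
have /andP[y1 y2] := floor_itv y.
have H1 : (2 * Num.floor y <= Num.floor (2 * y))%R.
  by rewrite floor_ge_int intrM ler_pM2l.
have H2 : (Num.floor (2 * y) < 2 * Num.floor y + 2)%R.
  rewrite -(ltr_int R); apply: le_lt_trans (floor_le _) _.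
  by move: y2; rewrite !rmorphD/= intrM; lra.
have H3 : (Num.floor (2 * y) <= 2 * Num.floor y + 1)%R by lia.
move: H1; rewrite -(ler_int R) intrM => H1.
move: H3; rewrite -(ler_int R) rmorphD/= intrM => H3.
by apply/andP; split; lra.
Qed.

Lemma floor_digit n x :
  (Num.floor (2 ^+ n.+1 * x))%:~R = 2 * (Num.floor (2 ^+ n * x))%:~R + digit n x.
Proof. by rewrite /digit addrC subrK. Qed.

Lemma floor_small k n (x : R) : (k <= n)%N -> 0 <= x < 2 ^- n ->
  Num.floor (2 ^+ k * x) = 0.
Proof.
move=> kn /andP[x0 xn]; apply: floor_def; rewrite mulr_ge0 ?exprn_ge0//= add0r.
rewrite -ltr_pdivlMl ?exprn_gt0// mulr1 (lt_le_trans xn)//.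
by rewrite lef_pV2 ?posrE ?exprn_gt0// ler_eXn2l ?ltr1n.
Qed.

Lemma digit_small n (x : R) i : 0 <= x < 2 ^- n -> (i < n)%N -> digit i x = 0.
Proof.
move=> xn ni; rewrite /digit !(@floor_small _ n)// ?mulr0 ?subr0//.
exact: ltnW.
Qed.

(** Adding [2 ^- n.+1] to a number below it sets the [n]-th digit without any
    carry. *)
Lemma digit_shift n (x : R) i : 0 <= x < 2 ^- n.+1 ->
  digit i (x + 2 ^- n.+1) = digit i x + (i == n)%:R.
Proof.
move=> x0n; have /andP[x0 xn] := x0n.
have half2 : 2 ^- n = 2 ^- n.+1 + 2 ^- n.+1 :> R.
  by rewrite exprS invfM; field; rewrite expf_neq0.
have xn' : 0 <= x < 2 ^- n by rewrite x0 half2 ltr_wpDr// invr_ge0 exprn_ge0.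
have yn' : 0 <= x + 2 ^- n.+1 < 2 ^- n.
  by rewrite half2 ltrD2r xn addr_ge0// invr_ge0 exprn_ge0.
have large k : (n < k)%N ->
    Num.floor (2 ^+ k * (x + 2 ^- n.+1)) = Num.floor (2 ^+ k * x) + (2 ^ (k - n.+1))%N.
  move=> nk; rewrite mulrDr -exprB ?unitfE// floorDrz.
    by congr (_ + _); rewrite -natrX pmulrn intrKfloor.
  by rewrite rpredX// rpred_nat.
rewrite /digit; case: (ltngtP i n) => [lt_in|lt_ni|->].
- by rewrite !(@floor_small _ n) ?addr0// ltnW.
- rewrite (large _ lt_ni) (large _ (leqW lt_ni)) subSS -(subnSK lt_ni) expnS.
  by rewrite PoszM !intrD intrM addr0; lra.
- by rewrite large// subnn expn0 !(@floor_small n n)// rmorphD/=; lra.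
Qed.

Variable e : nat -> nat.
Hypothesis e_incr : forall n, (e n < e n.+1)%N.
Local Notation w := (@weight R e).

Lemma weight_halves n : 2 * w n.+1 <= w n.
Proof.
rewrite /weight (exprS _ (e n.+1)) invfM mulVKf ?pnatr_eq0//.
by rewrite lef_pV2 ?posrE ?exprn_gt0// ler_eXn2l ?ltr1n.
Qed.

Definition digit_term x i := digit i x * w i.

Lemma digit_term_ge0 x i : 0 <= digit_term x i.
Proof. by rewrite mulr_ge0 ?(ltW (weight_gt0 _ _))//; case/andP: (digit_itv i x). Qed.

(** Each weight is at least twice the next one, so a tail of the series of
    weights is at most twice its first term. *)
Lemma series_digit_le x n m : (n <= m)%N ->
  series (digit_term x) m <= series (digit_term x) n + 2 * w n - 2 * w m.
Proof.
elim: m => [|m IH]; first by rewrite leqn0 => /eqP ->; rewrite addrK.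
rewrite leq_eqVlt => /predU1P[->|]; first by rewrite addrK.
rewrite ltnS => /IH; rewrite !/(series _ m.+1) /series/= !big_nat_recr//= /digit_term.
have /andP[d0 d1] := digit_itv m x; have w0 := weight_gt0 (R:=R) e m.
have := ler_wpM2r (ltW w0) d1; rewrite mul1r.
have := weight_halves m; lra.
Qed.

Lemma series_digit_homo x : nondecreasing_seq (series (digit_term x)).
Proof.
apply/nondecreasing_seqP => n; rewrite /series/= big_nat_recr//= lerDl.
exact: digit_term_ge0.
Qed.

Lemma is_cvg_digit_series x : cvgn (series (digit_term x)).
Proof.
apply: nondecreasing_is_cvgn; first exact: series_digit_homo.
exists (2 * w 0%N) => _ [n _ <-].
have := series_digit_le x (leq0n n); have := weight_gt0 (R:=R) e n.
rewrite [series _ 0%N]/series/= big_geq//; lra.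
Qed.

(** The real number obtained from [x] by moving its [n]-th binary digit to the
    binary place [(e n).+1]. *)
Definition spread x : R := limn (series (digit_term x)).

Lemma spread_ge x n : series (digit_term x) n <= spread x.
Proof.
exact: nondecreasing_cvgn_le (@series_digit_homo x) (is_cvg_digit_series (x:=x)) n.
Qed.

Lemma spread_le x n : spread x <= series (digit_term x) n + 2 * w n.
Proof.
apply: limr_le; first exact: is_cvg_digit_series.
exists n => // m /= nm; have := series_digit_le x nm.
have := weight_gt0 (R:=R) e m; lra.
Qed.

Lemma spread_small n x : 0 <= x < 2 ^- n -> 0 <= spread x <= 2 * w n.
Proof.
move=> xn; have H : series (digit_term x) n = 0.
  rewrite /series/= big_nat big1// => i /andP[_ ni].
  by rewrite /digit_term (digit_small xn)// mul0r.
by have := spread_ge x n; have := spread_le x n; rewrite H add0r => -> ->.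
Qed.

Lemma spread_shift n (x : R) : 0 <= x < 2 ^- n.+1 ->
  spread (x + 2 ^- n.+1) = w n + spread x.
Proof.
move=> xn; apply/cvg_lim => //.
have : (fun m => w n + series (digit_term x) m) @ \oo --> w n + spread x.
  by apply: cvgD; [exact: cvg_cst|exact: is_cvg_digit_series].
apply: cvg_trans; apply: near_eq_cvg; exists n.+1 => // m /= nm.
rewrite /series/= [RHS](eq_bigr (fun i => digit_term x i + (i == n)%:R * w i)).
  rewrite big_split/= addrC; congr (_ + _).
  rewrite (bigD1_seq n) ?mem_index_iota ?iota_uniq//= eqxx mul1r.
  by rewrite big1 ?addr0// => i /negPf ->; rewrite mul0r.
by move=> i _; rewrite /digit_term digit_shift// mulrDl.
Qed.

Lemma measurable_spread : measurable_fun [set: R] spread.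
Proof.
have mfl k : measurable_fun [set: R] (fun x : R => (Num.floor (2 ^+ k * x))%:~R : R).
  apply: nondecreasing_measurable => // x y xy.
  by rewrite ler_int le_floor// ler_pM2l// exprn_gt0.
apply: (@measurable_fun_cvg _ _ _ _ (fun n x => series (digit_term x) n)) => [n|x _].
  rewrite /series/=; apply: measurable_sum => i.
  apply: measurable_funM => //; apply: measurable_funB => //.
  exact: measurable_funM.
exact: is_cvg_digit_series.
Qed.

(** By induction on the level: from one level to the next the difference of the
    integer parts doubles, up to the new digits, whereas the weight is at least
    halved. *)
Lemma series_digit_expand n x y : x <= y ->
  Num.floor x = 0 -> Num.floor y = 0 ->
  ((Num.floor (2 ^+ n.+1 * y))%:~R - (Num.floor (2 ^+ n.+1 * x))%:~R) * w n <=
  series (digit_term y) n.+1 - series (digit_term x) n.+1.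
Proof.
move=> xy fx fy; elim: n => [|n IH].
  rewrite /series/= !big_nat1 /digit_term -mulrBl !floor_digit expr0 !mul1r fx fy.
  by rewrite mulr0 !add0r.
have fxy : 0 <= (Num.floor (2 ^+ n.+1 * y))%:~R - (Num.floor (2 ^+ n.+1 * x))%:~R :> R.
  by rewrite subr_ge0 ler_int le_floor// ler_pM2l// exprn_gt0.
have := ler_wpM2l fxy (weight_halves n).
rewrite (floor_digit n.+1 y) (floor_digit n.+1 x).
have series_recr z : series (digit_term z) n.+2 =
    series (digit_term z) n.+1 + digit n.+1 z * w n.+1.
  by rewrite /series/= big_nat_recr.
rewrite !series_recr; lra.
Qed.

(** Two dyadic intervals of one level that are not adjacent have images at
    positive distance. For adjacent ones this may fail, the tail of the series
    being able to fill the gap, hence the shift by 2. *)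
Lemma spread_expand n x y : x <= y -> Num.floor x = 0 -> Num.floor y = 0 ->
  (Num.floor (2 ^+ n.+1 * x) + 2 <= Num.floor (2 ^+ n.+1 * y))%R ->
  w n <= spread y - spread x.
Proof.
move=> xy fx fy; rewrite -(ler_int R) rmorphD/= => H.
have := series_digit_expand n xy fx fy.
have := spread_ge y n.+1; have := spread_le x n.+1.
have := weight_halves n; have := weight_gt0 (R:=R) e n.
nra.
Qed.

(** Take the first level [m.+1] at which [x] and [y] lie in dyadic intervals
    that are not adjacent: then [y - x < 2 * 2 ^- m] by minimality, while their
    images are at distance at least the [m]-th weight. *)
Lemma spread_inverse_hoelder (t C : R) : 0 <= t -> 0 <= C ->
  (forall m, 2 ^- m <= C * w m `^ t) ->
  forall x y : R, 0 <= x < 1 -> 0 <= y < 1 ->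
    `|x - y| <= 2 * C * `|spread x - spread y| `^ t.
Proof.
move=> t0 C0 HC x y x01 y01.
wlog xy : x y x01 y01 / x <= y => [H|].
  case/orP: (le_total x y) => [xy|yx]; first exact: H.
  by rewrite distrC [X in X `^ _]distrC; exact: H.
have [<-|neq_xy] := eqVneq x y.
  by rewrite subrr normr0 mulr_ge0 ?powR_ge0// mulr_ge0.
have lt_xy : x < y by rewrite lt_neqAle neq_xy.
have int2 (a b : int) : (a < b + 2)%R -> (a <= b + 1)%R by clear; lia.
have f0 (z : R) : 0 <= z < 1 -> Num.floor z = 0 by move=> ?; apply: floor_def.
pose sep n := (Num.floor (2 ^+ n * x) + 2 <= Num.floor (2 ^+ n * y))%R.
have : exists n, sep n.
  pose n := (Num.trunc (3 / (y - x))).+1.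
  have : 3 <= 2 ^+ n * (y - x).
    rewrite -ler_pdivrMr ?subr_gt0// ltW// (lt_trans (truncnS_gt _))//.
    by rewrite -natrX ltr_nat ltn_expl.
  exists n; rewrite /sep floor_ge_int rmorphD/=.
  have := floor_le (2 ^+ n * x); lra.
move=> /ex_minnP[[|m] sepm minm].
  by move: sepm; rewrite /sep expr0 !mul1r !f0.
have le_d : y - x <= 2 * 2 ^- m.
  have : ~~ sep m by apply/negP => /minm; rewrite ltnn.
  rewrite /sep -ltNge -(ltr_int R) rmorphD/=.
  have := floorD1_gt (2 ^+ m * y); have := floor_le (2 ^+ m * x).
  have := floor_le (2 ^+ m * y); rewrite rmorphD/= => H0 H1 H2 H3.
  have p0 : 0 < 2 ^+ m :> R by rewrite exprn_gt0.
  have H : 2 ^+ m * (y - x) <= 2.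
    have : (Num.floor (2 ^+ m * y) < Num.floor (2 ^+ m * x) + 2)%R.
      by rewrite -(ltr_int R) rmorphD.
    move=> /int2; rewrite -(ler_int R) rmorphD/=.
    move: H1 H2; clear; rewrite mulrBr; lra.
  by rewrite -ler_pdivlMl// mulrC in H.
have := spread_expand xy (f0 _ x01) (f0 _ y01) sepm => le_w.
rewrite distrC ger0_norm ?subr_ge0// (le_trans le_d)// -mulrA ler_pM2l//.
rewrite (le_trans (HC m))// ler_wpM2l// ge0_ler_powR// ?nnegrE//.
  exact/ltW/weight_gt0.
by rewrite distrC (le_trans le_w)// ler_norm.
Qed.

End digit_map.

(** * Folding integrals over dyadic intervals *)

Section translation.
Context {R : realType}.
Local Notation leb := (@lebesgue_measure R).

Lemma lebesgue_measure_translation (c : R) (A : set R) : measurable A ->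
  pushforward leb ((fun x => x - c) : R -> measurableTypeR R) A = leb A.
Proof.
have mc : measurable_fun [set: measurableTypeR R]
    ((fun x => x - c) : measurableTypeR R -> measurableTypeR R).
  exact: measurable_funB.
move=> mA; apply/esym.
pose mc_mixin := isMeasurableFun.Build _ _ _ _ _ mc.
pose f : {mfun measurableTypeR R >-> measurableTypeR R} :=
  HB.pack ((fun x => x - c) : measurableTypeR R -> measurableTypeR R) mc_mixin.
apply: (@lebesgue_measure_unique _ (pushforward leb f)) => //= _ [[a b]] _ <-.
rewrite /pushforward.
have -> : f @^-1` [set` `]a, b]] = [set` `]a + c, b + c]].
  by apply/seteqP; split => x /=; rewrite !in_itv/= ltrBrDr lerBlDr.
rewrite !lebesgue_measure_itv/= !lte_fin ltrD2r; case: ifPn => // _.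
by rewrite -!EFinB; congr EFin; lra.
Qed.

Lemma integral_translation (a b c : R) (f : R -> \bar R) :
  measurable_fun [set: R] f -> (forall x, 0 <= f x)%E ->
  (\int[leb]_(x in `[(a + c)%R, (b + c)%R[) f x = \int[leb]_(x in `[a, b[) f (x + c)%R)%E.
Proof.
move=> mf f0.
have mc : measurable_fun [set: measurableTypeR R]
    ((fun x => x - c) : measurableTypeR R -> measurableTypeR R).
  exact: measurable_funB.
have pre : ((fun x => x - c) : R -> R) @^-1` `[a, b[%classic = `[a + c, b + c[%classic.
  by apply/seteqP; split => x /=; rewrite !in_itv/= lerBrDr ltrBlDr.
pose T (x : measurableTypeR R) : measurableTypeR R := (x - c)%R.
transitivity (\int[pushforward leb T]_(x in `[a, b[) f (x + c)%R)%E.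
  rewrite (ge0_integral_pushforward mc)//=.
  - by rewrite pre; apply: eq_integral => x _ /=; rewrite subrK.
  - apply: measurable_funTS; apply: measurableT_comp => //.
    exact: measurable_funD.
by apply: eq_measure_integral => //= A mA AS; exact: lebesgue_measure_translation.
Qed.

Lemma integral_fold_half (a : R) (f : R -> \bar R) : 0 <= a ->
  measurable_fun [set: R] f -> (forall x, 0 <= f x)%E ->
  (\int[leb]_(x in `[0%R, (a + a)%R[) f x = \int[leb]_(x in `[0%R, a[) (f x + f (x + a)%R))%E.
Proof.
move=> a0 mf f0.
have mfa : measurable_fun [set: R] (fun x => f (x + a)).
  by apply: measurableT_comp => //; exact: measurable_funD.
rewrite ge0_integralD//; try exact: measurable_funTS.
rewrite -integral_translation// add0r -ge0_integral_setU//=.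
- congr integral; apply/seteqP; split => x /=; rewrite !in_itv/=.
    move=> /andP[x0 xaa]; case: (ltP x a) => xa; [left|right] => //.
    by rewrite x0.
  case=> /andP[h1 h2]; first by rewrite h1 (lt_le_trans h2)// lerDl.
  by rewrite h2 (le_trans a0).
- exact: measurable_funTS.
- apply/disj_setPS => x [] /=; rewrite !in_itv/= => /andP[_ xa] /andP[ax _].
  by move: (lt_le_trans xa ax); rewrite ltxx.
Qed.

End translation.

Section bit_sums.
Context {R : pzSemiRingType}.

(** The sum of the [u i] over the positions [i < n] of the ones in the binary
    expansion of [j]. Peeling off the highest bit first makes the sums of level
    [n] an initial segment of those of level [n.+1]. *)
Fixpoint bitsum (u : nat -> R) (n j : nat) : R :=
  if n is m.+1 then
    if (j < 2 ^ m)%N then bitsum u m j else bitsum u m (j - 2 ^ m) + u m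
  else 0.

Lemma bitsumS u n j : bitsum u n.+1 j =
  if (j < 2 ^ n)%N then bitsum u n j else bitsum u n (j - 2 ^ n) + u n.
Proof. by []. Qed.

Lemma bitsum_lo u n j : (j < 2 ^ n)%N -> bitsum u n.+1 j = bitsum u n j.
Proof. by move=> /= ->. Qed.

Lemma bitsum_hi u n j : bitsum u n.+1 (j + 2 ^ n) = bitsum u n j + u n.
Proof. by rewrite /= ltnNge leq_addl addnK. Qed.

Lemma bitsum_widen u n m j : (n <= m)%N -> (j < 2 ^ n)%N ->
  bitsum u m j = bitsum u n j.
Proof.
elim: m => [|m IH]; first by rewrite leqn0 => /eqP ->.
rewrite leq_eqVlt => /predU1P[->//|]; rewrite ltnS => nm jn.
by rewrite bitsum_lo ?IH// (leq_trans jn)// leq_exp2l.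
Qed.

End bit_sums.

Lemma sum_expn2 (V : nmodType) n (F : nat -> V) :
  \sum_(0 <= j < 2 ^ n.+1) F j =
  \sum_(0 <= j < 2 ^ n) F j + \sum_(0 <= j < 2 ^ n) F (j + 2 ^ n)%N.
Proof.
have le2 : (2 ^ n <= 2 ^ n.+1)%N by rewrite leq_exp2l.
rewrite (big_cat_nat (n := 2 ^ n))//=; congr (_ + _).
by rewrite -[X in \sum_(X <= _ < _) _]add0n big_addn expnS mul2n -addnn addnK.
Qed.

Section fold.
Context {R : realType}.
Local Notation leb := (@lebesgue_measure R).

(** The multiples of [2 ^- n] in [0, 1[, enumerated in bit-reversed order, so
    that they are indexed like the frequencies. *)
Definition dyadic (n j : nat) : R := bitsum (fun i => 2 ^- i.+1) n j.

(** The translates by the dyadic points of level [n] of the interval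
    [0, 2 ^- n[ tile [0, 1[. *)
Lemma integral_fold n (f : R -> \bar R) :
  measurable_fun [set: R] f -> (forall x, 0 <= f x)%E ->
  (\int[leb]_(x in `[0%R, 1%R[) f x =
   \int[leb]_(x in `[0%R, (2 ^- n)%R[) \sum_(0 <= j < 2 ^ n) f (dyadic n j + x)%R)%E.
Proof.
move=> mf f0; elim: n => [|n ->].
  rewrite expr0 invr1; apply: eq_integral => x _.
  by rewrite expn0 big_nat1 /dyadic/= add0r.
have half2 : 2 ^- n = 2 ^- n.+1 + 2 ^- n.+1 :> R.
  by rewrite exprS invfM; field; rewrite expf_neq0.
rewrite half2 integral_fold_half//.
- apply: eq_integral => x _; rewrite sum_expn2; congr (_ + _)%E.
    by apply: eq_big_nat => j /andP[_ jn]; rewrite /dyadic bitsum_lo.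
  by apply: eq_bigr => j _; rewrite /dyadic bitsum_hi addrA addrAC.
- apply: emeasurable_sum => j; apply: measurableT_comp => //.
  exact: measurable_funD.
- by move=> x; apply: sume_ge0.
Qed.

Lemma dyadic_itv n j : (j < 2 ^ n)%N -> 0 <= dyadic n j <= 1 - 2 ^- n.
Proof.
elim: n j => [|n IH] j.
  by rewrite expn0 ltnS leqn0 => /eqP ->; rewrite /dyadic/= expr0 invr1 subrr lexx.
have half2 : 2 ^- n = 2 ^- n.+1 + 2 ^- n.+1 :> R.
  by rewrite exprS invfM; field; rewrite expf_neq0.
have p0 : 0 < 2 ^- n.+1 :> R by rewrite invr_gt0 exprn_gt0.
case: (ltnP j (2 ^ n)) => jn.
  by move=> _; rewrite /dyadic bitsum_lo//; have := IH _ jn; rewrite /dyadic; lra.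
rewrite -(subnK jn) /dyadic bitsum_hi expnS mul2n -addnn ltn_add2r => /IH.
by rewrite /dyadic; lra.
Qed.

Lemma dyadic_locate n (x : R) : 0 <= x < 1 ->
  exists2 j, (j < 2 ^ n)%N & dyadic n j <= x < dyadic n j + 2 ^- n.
Proof.
move=> x01; elim: n => [|n [j jn]].
  by exists 0%N => //; rewrite /dyadic/= expr0 invr1 add0r.
have half2 : 2 ^- n = 2 ^- n.+1 + 2 ^- n.+1 :> R.
  by rewrite exprS invfM; field; rewrite expf_neq0.
rewrite half2 => /andP[x1 x2].
case: (ltP x (dyadic n j + 2 ^- n.+1)) => xj.
  exists j; first by rewrite (leq_trans jn)// leq_exp2l.
  by rewrite /dyadic bitsum_lo// x1.
exists (j + 2 ^ n)%N; first by rewrite expnS mul2n -addnn ltn_add2r.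
by rewrite /dyadic bitsum_hi xj -addrA.
Qed.

End fold.

(** * Exponential sums at the nodes *)

Section circle.
Context {R : realType}.
Local Open Scope complex_scope.

Definition cis (x : R) : R[i] := cos (2 * pi * x) +i* sin (2 * pi * x).

Lemma exponentialE (l x : R) : exponential l x = cis (l * x).
Proof. by rewrite /exponential /cis mulrA. Qed.

Lemma cis0 : cis 0 = 1.
Proof. by rewrite /cis mulr0 cos0 sin0. Qed.

Lemma cisD x y : cis (x + y) = cis x * cis y.
Proof. by rewrite /cis mulrDr cosD sinD; simpc; congr (_ +i* _); rewrite addrC. Qed.

Lemma cis_half : cis 2^-1 = -1.
Proof.
rewrite /cis mulrAC divff ?pnatr_eq0// mul1r cospi sinpi.
by apply/eqP; rewrite eq_complex /= oppr0 !eqxx.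
Qed.

Lemma cis_nat (n : nat) : cis n%:R = 1.
Proof.
elim: n => [|n IH]; first exact: cis0.
rewrite -natr1 cisD IH mul1r [X in cis X](_ : 1 = 2^-1 + 2^-1); last by lra.
by rewrite cisD cis_half mulrNN mulr1.
Qed.

Lemma conj_cis x : (cis x)^*%R = cis (- x).
Proof. by rewrite /cis mulrN cosN sinN. Qed.

Lemma mul_cis_conj x : cis x * (cis x)^* = 1.
Proof. by rewrite conj_cis -cisD subrr cis0. Qed.

End circle.

Section nodes.
Context {R : realType}.
Variable e : nat -> nat.
Hypothesis e_incr : forall n, (e n < e n.+1)%N.
Local Notation w := (@weight R e).
Local Open Scope complex_scope.

Definition freq (n j : nat) : R := bitsum (fun i => 2 ^+ e i) n j.

Definition node (n j : nat) : R := bitsum w n j.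

Lemma e_nondecreasing i n : (i <= n)%N -> (e i <= e n)%N.
Proof.
elim: n => [|n IH]; first by rewrite leqn0 => /eqP ->.
by rewrite leq_eqVlt => /predU1P[->//|]; rewrite ltnS => /IH/leq_trans; apply; exact: ltnW.
Qed.

Lemma freq_ge0 n j : 0 <= freq n j.
Proof.
elim: n j => [//|n IH] j /=; rewrite /freq/=.
by case: ifP => _; [exact: IH|rewrite addr_ge0 ?exprn_ge0//; exact: IH].
Qed.

(** The powers [2 ^ e i] at least double at each step. *)
Lemma freq_le n j : freq n.+1 j <= 2 ^+ (e n).+1.
Proof.
elim: n j => [|n IH] j.
  rewrite /freq/= exprS; case: ifP => _; rewrite ?add0r ?mulr_ge0 ?exprn_ge0//.
  by rewrite ler_peMl ?exprn_ge0// ler1n.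
have H k : freq n.+1 k <= 2 ^+ e n.+1.
  by rewrite (le_trans (IH k))// ler_eXn2l ?ltr1n.
have p0 : 0 <= 2 ^+ e n.+1 :> R by rewrite exprn_ge0.
rewrite /freq bitsumS exprS.
by case: ifP => _; [have := H j|have := H (j - 2 ^ n.+1)%N]; rewrite /freq; lra.
Qed.

Lemma pow_node n m j : (m <= n)%N ->
  exists k : nat, 2 ^+ e n * node m j = k%:R.
Proof.
elim: m j => [|m IH] j mn; first by exists 0%N; rewrite /node/= mulr0.
rewrite /node/=; case: ifP => _; first exact: IH (ltnW mn).
have [k kE] := IH (j - 2 ^ m)%N (ltnW mn).
exists (k + 2 ^ (e n - (e m).+1))%N; rewrite mulrDr natrD kE; congr (_ + _).
by rewrite /weight natrX exprB ?unitfE// (leq_trans (e_incr m))// e_nondecreasing.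
Qed.

(** The new frequency is a multiple of the inverses of all earlier weights,
    so the exponential it carries is trivial on the nodes of level [n]. *)
Lemma cis_pow_node n j : cis (2 ^+ e n * node n j) = 1.
Proof. by have [k ->] := pow_node j (leqnn n); exact: cis_nat. Qed.

Lemma cis_pow_weight n : cis (2 ^+ e n * w n) = -1.
Proof.
by rewrite /weight exprS invfM mulrCA divff ?mulr1 ?cis_half// expf_neq0.
Qed.

Definition trig n (c : nat -> R[i]) j : R[i] :=
  \sum_(0 <= i < 2 ^ n) c i * cis (freq n i * node n j).

(** On the old nodes the two halves of the frequencies give the same
    exponentials, which adds their coefficients. *)
Lemma trig_lo n c j : (j < 2 ^ n)%N ->
  trig n.+1 c j = trig n (fun i => c i + c (i + 2 ^ n)%N) j.
Proof.
move=> jn; rewrite /trig sum_expn2 -big_split/=; apply: eq_big_nat => i /andP[_ i_n].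
rewrite /freq /node bitsum_hi !bitsum_lo// [(_ + 2 ^+ e n) * _]mulrDl cisD.
by rewrite [cis (2 ^+ e n * _)](cis_pow_node n j) mulr1 mulrDl.
Qed.

(** On the new nodes the two halves of the frequencies differ by the sign
    [cis (1 / 2)], which subtracts their coefficients, up to a unimodular
    factor. *)
Lemma trig_hi n c j :
  trig n.+1 c (j + 2 ^ n) =
  trig n (fun i => (c i - c (i + 2 ^ n)%N) * cis (freq n i * w n)) j.
Proof.
rewrite /trig sum_expn2 -big_split/=; apply: eq_big_nat => i /andP[_ i_n].
rewrite /freq /node !bitsum_hi !bitsum_lo// [(_ + 2 ^+ e n) * _]mulrDl.
rewrite !mulrDr !cisD [cis (2 ^+ e n * bitsum _ _ _)](cis_pow_node n j) cis_pow_weight.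
by ring.
Qed.

(** By [trig_lo] and [trig_hi], passing to the next level replaces the
    coefficients by their sums and differences, a transform that doubles the
    hermitian product. *)
Lemma trig_parseval n c d :
  \sum_(0 <= j < 2 ^ n) trig n c j * (trig n d j)^* =
  2 ^+ n * \sum_(0 <= i < 2 ^ n) c i * (d i)^*.
Proof.
elim: n c d => [|n IH] c d.
  rewrite expn0 !big_nat1 /trig expn0 !big_nat1 /freq/= mul0r cis0.
  by rewrite expr0 mul1r !mulr1.
rewrite !sum_expn2.
under eq_big_nat => j /andP[_ jn] do rewrite !trig_lo//.
under [X in _ + X]eq_big_nat => j /andP[_ jn] do rewrite !trig_hi//.
rewrite !IH -mulrDr exprSr -mulrA; congr (_ * _).
rewrite -!big_split mulr_sumr; apply: eq_big_nat => i _ /=.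
rewrite !rmorphM !rmorphB !rmorphD/=.
set u := cis _; have u1 : u * u^* = 1 by exact: mul_cis_conj.
rewrite [X in _ + X](_ : _ =
  (c i - c (i + 2 ^ n)%N) * ((d i)^* - (d (i + 2 ^ n)%N)^*) * (u * u^*)); last by ring.
by rewrite u1; ring.
Qed.

(** The transform of [trig_lo] and [trig_hi] is invertible. *)
Lemma trig_interpolation n (f : nat -> R[i]) :
  exists c, forall j, (j < 2 ^ n)%N -> trig n c j = f j.
Proof.
elim: n f => [|n IH] f.
  exists f => j; rewrite expn0 ltnS leqn0 => /eqP ->.
  by rewrite /trig expn0 big_nat1 /freq/= mul0r cis0 mulr1.
have [a aE] := IH f; have [b bE] := IH (fun j => f (j + 2 ^ n)%N).
pose u i := cis (freq n i * w n).
have uu i : u i * (u i)^* = 1 by exact: mul_cis_conj.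
pose c i := if (i < 2 ^ n)%N then (a i + b i * (u i)^*) / 2
  else (a (i - 2 ^ n)%N - b (i - 2 ^ n)%N * (u (i - 2 ^ n)%N)^*) / 2.
have n2 : 2 != 0 :> R[i] by rewrite pnatr_eq0.
exists c => j; case: (ltnP j (2 ^ n)) => jn jn1.
  rewrite trig_lo// -aE//; apply: eq_big_nat => i /andP[_ i_n].
  rewrite /c i_n ltnNge leq_addl/= addnK; congr (_ * _).
  by field.
have {}jn1 : (j - 2 ^ n < 2 ^ n)%N by move: jn1; rewrite expnS; lia.
rewrite -{1}(subnK jn) trig_hi -[in RHS](subnK jn) -bE//.
apply: eq_big_nat => i /andP[_ i_n]; congr (_ * _).
rewrite /c i_n ltnNge leq_addl/= addnK -/(u i).
transitivity (b i * (u i * (u i)^*)); last by rewrite uu mulr1.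
by field.
Qed.

(** Inside a dyadic interval only the later digits vary, and they contribute
    independently of the first ones. *)
Lemma spread_node n j (x : R) : (j < 2 ^ n)%N -> 0 <= x < 2 ^- n ->
  spread e (dyadic n j + x) = node n j + spread e x.
Proof.
elim: n j x => [|n IH] j x.
  by rewrite expn0 ltnS leqn0 => /eqP -> _; rewrite /dyadic/node/= !add0r.
have half2 : 2 ^- n = 2 ^- n.+1 + 2 ^- n.+1 :> R.
  by rewrite exprS invfM; field; rewrite expf_neq0.
have p0 : 0 < 2 ^- n.+1 :> R by rewrite invr_gt0 exprn_gt0.
case: (ltnP j (2 ^ n)) => jn jn1 /andP[x0 xn].
  rewrite /dyadic /node !bitsum_lo//; apply: IH => //; rewrite half2 x0/=; lra.
rewrite -(subnK jn) /dyadic /node !bitsum_hi addrAC -addrA IH.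
- by rewrite spread_shift// ?x0// -addrA.
- by move: jn1; rewrite expnS; lia.
- by rewrite half2; apply/andP; split; lra.
Qed.

End nodes.

(** * Density of continuous functions in the mean *)

Section uniform_continuity.
Context {R : realType}.

Lemma compact_uniformly_continuous (K : set R) (g : R -> R) (eps : R) :
  compact K -> continuous g -> 0 < eps ->
  exists2 d : R, 0 < d & forall x y, K x -> `|x - y| < d -> `|g x - g y| < eps.
Proof.
move=> /compact_near_coveringP cK cg eps0.
pose P (d x : R) := forall y, `|x - y| < d -> `|g x - g y| < eps.
have : \forall d \near 0^'+, K `<=` P d.
  apply: (cK R (0^'+) P) => x _.
  have e2 : 0 < eps / 2 by rewrite divr_gt0.
  have /cvgrPdist_lt/(_ _ e2) := cg x.
  move=> /nbhs_ballP[r /= r0 Hr].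
  exists (ball x (r / 2), [set d | d < r / 2]); first split.
  - exact: nbhsx_ballx (divr_gt0 r0 _).
  - by apply: nbhs_right_lt; rewrite divr_gt0.
  move=> [z d] /= [xz dr] y zy.
  have gz : `|g x - g z| < eps / 2.
    by apply: Hr; apply: le_ball xz; rewrite ler_pdivrMr// ler_peMr// ?ltW// ltr1n.
  have gy : `|g x - g y| < eps / 2.
    apply: Hr; rewrite /ball/= (splitr r) -(subrKA z) (le_lt_trans (ler_normD _ _))//.
    by rewrite ltrD// (lt_trans zy).
  rewrite (splitr eps) -(subrKA (g x)) (le_lt_trans (ler_normD _ _))//.
  by rewrite ltrD// distrC.
move=> H; have [d [d0 dP]] : exists d : R, 0 < d /\ K `<=` P d.
  near (0 : R)^'+ => d; exists d; split.
    by near: d; exact: nbhs_right_gt.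
  by near: d.
by exists d => // x y Kx; exact: dP.
Unshelve. all: by end_near. Qed.

End uniform_continuity.

Section truncation.
Context {R : realType}.

(** The nearest point projection on [[- M, M]]. *)
Definition clip (M x : R) : R := Num.max (- M) (Num.min x M).

Lemma clip_le M x : 0 <= M -> `|clip M x| <= M.
Proof.
move=> M0; rewrite ler_norml /clip le_max lexx/= ge_max ge_min lexx orbT andbT.
by rewrite (le_trans _ M0)// oppr_le0.
Qed.

Lemma clip_id M x : `|x| <= M -> clip M x = x.
Proof.
rewrite ler_norml => /andP[h1 h2]; rewrite /clip.
by rewrite (min_idPl h2) (max_idPr h1).
Qed.

Lemma clip_lipschitz M x y : `|clip M x - clip M y| <= `|x - y|.
Proof.
have h1 := ler_norm (x - y); have h2 : y - x <= `|x - y| by rewrite distrC ler_norm.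
rewrite ler_norml /clip /Order.max /Order.min.
by case: ifPn; case: ifPn; case: ifPn; case: ifPn; rewrite -?leNgt; lra.
Qed.

Lemma clip_residual_le M x : 0 <= M -> (x - clip M x) ^+ 2 <= x ^+ 2.
Proof.
move=> M0; rewrite /clip /Order.max /Order.min.
by case: ifPn; case: ifPn; rewrite -?leNgt; nra.
Qed.

Lemma continuous_clip M (g : R -> R) : continuous g -> continuous (clip M \o g).
Proof.
move=> cg x; apply: (@continuous_max R R (cst (- M)) (g \min cst M)).
  exact: cvg_cst.
by apply: continuous_min; [exact: cg|exact: cvg_cst].
Qed.

Lemma measurable_clip M (u : R -> R) : measurable_fun setT u ->
  measurable_fun setT (clip M \o u).
Proof.
by move=> mu; apply: measurable_maxr => //; exact: measurable_minr.
Qed.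

End truncation.

Section L2_density.
Context {R : realType}.
Local Notation leb := (@lebesgue_measure R).
Local Notation I01 := (`[0%R, 1%R[%classic : set R).

Let leb01 : leb I01 = 1%E.
Proof. by rewrite lebesgue_measure_itv/= lte_fin ltr01 oppr0 adde0. Qed.

(** The form in which the parallelogram inequality is used to add errors in
    the mean. *)
Lemma integral_lt_2D (f g h : R -> R) (a b : R) :
  measurable_fun setT f -> measurable_fun setT g -> measurable_fun setT h ->
  (forall x, 0 <= f x) -> (forall x, 0 <= g x) -> (forall x, 0 <= h x) ->
  (forall x, 0 <= x < 1 -> h x <= 2 * f x + 2 * g x) ->
  (\int[leb]_(x in I01) (f x)%:E < a%:E)%E ->
  (\int[leb]_(x in I01) (g x)%:E < b%:E)%E ->
  (\int[leb]_(x in I01) (h x)%:E < (2 * a + 2 * b)%:E)%E.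
Proof.
move=> mf mg mh f0 g0 h0 hfg fa gb.
have mI : measurable I01 by exact: measurable_itv.
have mE (k : R -> R) : measurable_fun setT k ->
    measurable_fun I01 (fun x => (k x)%:E).
  by move=> mk; apply/measurable_EFinP; exact: measurable_funTS.
apply: (@le_lt_trans _ _ (\int[leb]_(x in I01) (2%:E * (f x)%:E + 2%:E * (g x)%:E))%E).
  apply: ge0_le_integral => //.
  - by move=> x _; rewrite lee_fin.
  - exact: mE.
  - by apply: emeasurable_funD; apply: measurable_funeM; exact: mE.
rewrite ge0_integralD//.
- rewrite !ge0_integralZl_EFin//; try exact: mE; try by move=> x _; rewrite lee_fin.
  by rewrite (EFinD (2 * a)) (EFinM 2 a) (EFinM 2 b) lteD// lte_pmul2l.
- by move=> x _; rewrite -EFinM lee_fin mulr_ge0.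
- by apply: measurable_funeM; exact: mE.
- by move=> x _; rewrite -EFinM lee_fin mulr_ge0.
- by apply: measurable_funeM; exact: mE.
Qed.

Lemma truncation_L2 (u : R -> R) (eps : R) : measurable_fun setT u ->
  (\int[leb]_(x in I01) (u x ^+ 2)%:E < +oo)%E -> 0 < eps ->
  exists2 M : R, 0 < M &
    (\int[leb]_(x in I01) ((u x - clip M (u x)) ^+ 2)%:E < eps%:E)%E.
Proof.
move=> mu u2 eps0.
have mI : measurable I01 by exact: measurable_itv.
pose f_ n (x : R) := ((u x - clip n.+1%:R (u x)) ^+ 2)%:E.
have mf n : measurable_fun I01 (f_ n).
  apply/measurable_EFinP; apply: measurable_funTS; apply: measurable_funX.
  by apply: measurable_funB => //; exact: measurable_clip.
have mu2 : measurable_fun I01 (fun x => (u x ^+ 2)%:E).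
  by apply/measurable_EFinP; apply: measurable_funTS; apply: measurable_funX.
have [] := @dominated_convergence _ _ _ leb I01 mI f_ (cst 0%E)
    (fun x => (u x ^+ 2)%:E) mf (measurable_cst _).
- apply/nearW => x _; apply: cvg_near_cst.
  exists (Num.trunc `|u x|) => // n /= xn; rewrite /f_ clip_id ?subrr ?expr0n//.
  by rewrite ltW// (lt_le_trans (truncnS_gt _))// ler_nat ltnS.
- apply/integrableP; split => //; apply: le_lt_trans u2.
  apply: ge0_le_integral => //.
  + exact: measurableT_comp.
  + by move=> x _; rewrite gee0_abs// lee_fin sqr_ge0.
- by apply/nearW => x n _; rewrite gee0_abs ?lee_fin ?sqr_ge0// clip_residual_le.
move=> _ _; rewrite integral0 => /fine_cvgP[fin_f].
move=> /cvgrPdist_lt/(_ _ eps0) H.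
have [n _ /(_ n (leqnn n)) [Hn fn]] := filterI H fin_f.
exists n.+1%:R => //.
move: fn Hn; rewrite /= sub0r normrN => /fineK <- /(le_lt_trans (ler_norm _)).
by rewrite lte_fin.
Qed.

(** Truncation reduces the claim to a bounded function, which a continuous
    function approximates in the mean; once that function is truncated at the
    same height, the square of the error is at most a constant times the
    error. *)
Lemma continuous_dense_L2 (u : R -> R) (eps : R) : measurable_fun setT u ->
  (\int[leb]_(x in I01) (u x ^+ 2)%:E < +oo)%E -> 0 < eps ->
  exists (g : R -> R) (M : R), [/\ continuous g, forall x, `|g x| <= M &
    (\int[leb]_(x in I01) ((u x - g x) ^+ 2)%:E < eps%:E)%E].
Proof.
move=> mu u2 eps0; have eps4 : 0 < eps / 4 by rewrite divr_gt0.
have [M M0 HM] := truncation_L2 mu u2 eps4.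
have mI : measurable I01 by exact: measurable_itv.
have I01fin : (leb I01 < +oo)%E by rewrite leb01 ltry.
pose v := clip M \o u; have mv : measurable_fun setT v by exact: measurable_clip.
have iv : leb.-integrable I01 (EFin \o v).
  apply: measurable_bounded_integrable => //; first exact: measurable_funTS.
  exists M; split; first exact: num_real.
  by move=> y My x _; apply: le_trans (ltW My); exact: clip_le (ltW M0).
have [g_ [cg ig]] := approximation_continuous_integrable mI I01fin iv.
have d0 : 0 < eps / 4 / (2 * M) by rewrite divr_gt0// mulr_gt0.
move=> /fine_cvgP[fin_f] /cvgrPdist_lt/(_ _ d0) H.
have [n _ /(_ n (leqnn n)) [Hn fn]] := filterI H fin_f.
have {H fin_f} Hn : (\int[leb]_(x in I01) (`|v x - g_ n x|)%:E < (eps / 4 / (2 * M))%:E)%E.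
  move: fn Hn; rewrite /= sub0r normrN => /fineK <- /(le_lt_trans (ler_norm _)).
  by rewrite lte_fin.
have mg : measurable_fun setT (clip M \o g_ n).
  by apply: measurable_clip; exact: continuous_measurable_fun.
exists (clip M \o g_ n), M; split.
- exact: continuous_clip.
- by move=> x; exact: clip_le (ltW M0).
rewrite (_ : eps = 2 * (eps / 4) + 2 * (eps / 4)); last by field.
apply: (integral_lt_2D (f := fun x => (u x - v x) ^+ 2)
  (g := fun x => (v x - clip M (g_ n x)) ^+ 2)) => //; try by move=> x; exact: sqr_ge0.
- by apply: measurable_funX; exact: measurable_funB.
- by apply: measurable_funX; exact: measurable_funB.
- by apply: measurable_funX; exact: measurable_funB.
- move=> x _ /=; rewrite -subr_ge0.
  rewrite [X in 0 <= X](_ : _ = ((u x - v x) - (v x - clip M (g_ n x))) ^+ 2); last by ring.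
  exact: sqr_ge0.
apply: (@le_lt_trans _ _ (\int[leb]_(x in I01) ((2 * M)%:E * (`|v x - g_ n x|)%:E))%E).
  apply: ge0_le_integral => //.
  - by move=> x _; rewrite lee_fin sqr_ge0.
  - apply/measurable_EFinP; apply: measurable_funTS; apply: measurable_funX.
    exact: measurable_funB.
  - apply: measurable_funeM; apply/measurable_EFinP; apply: measurable_funTS.
    apply: measurableT_comp => //; apply: measurable_funB => //.
    exact: continuous_measurable_fun.
  - move=> x _; rewrite -EFinM lee_fin -real_normK ?num_real// expr2.
    have vc : v x = clip M (v x) by rewrite clip_id// clip_le// ltW.
    rewrite ler_pM//.
      rewrite (le_trans (ler_normB _ _))// mulr2n mulrDl mul1r lerD// clip_le// ltW//.
    by rewrite {1}vc clip_lipschitz.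
rewrite ge0_integralZl_EFin//.
- rewrite -lte_pdivlMl ?mulr_gt0//.
  by rewrite -EFinM mulrC.
- apply/measurable_EFinP; apply: measurable_funTS.
  apply: measurableT_comp => //; apply: measurable_funB => //.
  exact: continuous_measurable_fun.
- by rewrite mulr_ge0// ltW.
Qed.

End L2_density.

(** * The measure and its spectrum *)

Section complex_modulus.
Context {R : realType}.

Definition sqmod (z : R[i]) : R := complex.Re z ^+ 2 + complex.Im z ^+ 2.

Lemma sqmod_ge0 z : 0 <= sqmod z.
Proof. by rewrite addr_ge0 ?sqr_ge0. Qed.

Lemma sqr_normc_sqmod z : Normc.normc z ^+ 2 = sqmod z.
Proof. by case: z => a b; rewrite /sqmod /= sqr_sqrtr// addr_ge0 ?sqr_ge0. Qed.

Lemma mul_conj_sqmod z : z * z^* = (sqmod z)%:C%C.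
Proof. by case: z => a b; rewrite /sqmod; simpc => /=; congr (_ +i* _)%C; ring. Qed.

Lemma sqmodM z1 z2 : sqmod (z1 * z2) = sqmod z1 * sqmod z2.
Proof. by case: z1 => a b; case: z2 => c d; rewrite /sqmod; simpc => /=; ring. Qed.

Lemma sqmodD_le z1 z2 : sqmod (z1 + z2) <= 2 * sqmod z1 + 2 * sqmod z2.
Proof.
case: z1 => a b; case: z2 => c d; rewrite /sqmod; simpc => /=.
rewrite -subr_ge0 [X in 0 <= X](_ : _ = (a - c) ^+ 2 + (b - d) ^+ 2); last by ring.
by rewrite addr_ge0 ?sqr_ge0.
Qed.

Lemma Re_sum (I : Type) (r : seq I) (F : I -> R[i]) :
  complex.Re (\sum_(i <- r) F i) = \sum_(i <- r) complex.Re (F i).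
Proof. by apply: big_morph => // -[a b] [c d]. Qed.

Lemma Im_sum (I : Type) (r : seq I) (F : I -> R[i]) :
  complex.Im (\sum_(i <- r) F i) = \sum_(i <- r) complex.Im (F i).
Proof. by apply: big_morph => // -[a b] [c d]. Qed.

Lemma sqmod_cis (x : R) : sqmod (cis x) = 1.
Proof. by rewrite /sqmod/= cos2Dsin2. Qed.

End complex_modulus.

Section L2_norm.
Context {R : realType} (nu : {measure set R -> \bar R}).

Lemma L2normE (f : R -> R[i]) :
  L2norm nu f = ((\int[nu]_x (sqmod (f x))%:E) `^ 2^-1)%E.
Proof.
rewrite /L2norm unlock; congr (_ `^ _)%E; apply: eq_integral => x _ /=.
rewrite -sqr_normc_sqmod powR_mulrn// real_normK// num_real.
by [].
Qed.

Lemma L2norm_lt (f : R -> R[i]) (eps : R) : 0 < eps ->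
  (\int[nu]_x (sqmod (f x))%:E < (eps ^+ 2)%:E)%E -> (L2norm nu f < eps%:E)%E.
Proof.
move=> eps0; rewrite L2normE.
have : (0 <= \int[nu]_x (sqmod (f x))%:E)%E.
  by apply: integral_ge0 => x _; rewrite lee_fin sqmod_ge0.
case: (\int[nu]_x _)%E => // r; rewrite lee_fin lte_fin => r0 rlt.
rewrite poweR_EFin lte_fin.
rewrite -[X in _ < X](_ : (eps ^+ 2) `^ 2^-1 = _).
  by rewrite gt0_ltr_powR// nnegrE// exprn_ge0// ltW.
by rewrite powR12_sqrt ?exprn_ge0 ?ltW// sqrtr_sqr ger0_norm// ltW.
Qed.

Lemma inL2_lty (f : R -> R[i]) :
  inL2 nu f -> (\int[nu]_x (sqmod (f x))%:E < +oo)%E.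
Proof. by case=> _ _; rewrite L2normE; apply: lty_poweRy; rewrite invr_eq0. Qed.

End L2_norm.

Section spread_measure.
Context {R : realType}.
Variable e : nat -> nat.
Hypothesis e_incr : forall n, (e n < e n.+1)%N.
Local Notation leb := (@lebesgue_measure R).
Local Notation w := (@weight R e).

Let mspread : measurable_fun [set: measurableTypeR R] (spread e : measurableTypeR R -> R).
Proof. exact: measurable_spread. Qed.

Definition spread_measure : {measure set R -> \bar R}.
Proof.
refine (pushforward (uniform_prob (@ltr01 R)) (spread e : measurableTypeR R -> R)).
exact: mspread.
Defined.

Local Notation nu := spread_measure.

Lemma spread_measureE (A : set R) :
  nu A = uniform_prob (@ltr01 R) (spread e @^-1` A).
Proof. by []. Qed.

Lemma spread_measureT : nu setT = 1%E.
Proof. by rewrite spread_measureE preimage_setT probability_setT. Qed.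

Lemma integral_spread (f : R -> \bar R) :
  measurable_fun [set: R] f -> (forall x, 0 <= f x)%E ->
  (\int[nu]_x f x = \int[leb]_(x in `[0%R, 1%R[) f (spread e x))%E.
Proof.
move=> mf f0; rewrite ge0_integral_pushforward//.
have mfs : measurable_fun [set: R] (f \o spread e) by exact: measurableT_comp.
rewrite preimage_setT integral_uniform//; last by move=> x; exact: f0.
rewrite subr0 invr1 mul1e -integral_itv_bndo_bndc//.
exact: measurable_funTS.
Qed.

(** The measure is the average of the translates of one and the same small
    measure by the nodes of level [n]. *)
Lemma integral_spread_fold n (f : R -> \bar R) :
  measurable_fun [set: R] f -> (forall x, 0 <= f x)%E ->
  (\int[nu]_x f x = \int[leb]_(x in `[0%R, (2 ^- n)%R[)
     \sum_(0 <= j < 2 ^ n) f (node e n j + spread e x)%R)%E.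
Proof.
move=> mf f0; rewrite integral_spread// (integral_fold n)//; last exact: measurableT_comp.
apply: eq_integral => x; rewrite inE/= in_itv/= => x0n.
by apply: eq_big_nat => j /andP[_ jn]; rewrite spread_node.
Qed.

(** Since the fold formula is available for nonnegative functions, it is applied
    to [1 + h]. *)
Lemma Rintegral_balanced n (h : R -> R) : measurable_fun [set: R] h ->
  (forall x, `|h x| <= 1) ->
  (forall x, \sum_(0 <= j < 2 ^ n) h (node e n j + x) = 0) ->
  (\int[nu]_x h x)%R = 0.
Proof.
move=> mh h1 h_bal.
have nuT : (nu setT < +oo)%E by rewrite spread_measureT ltry.
have ih : nu.-integrable setT (EFin \o h).
  apply: measurable_bounded_integrable => //.
  by exists 1; split; [exact: num_real|move=> y y1 x _; exact: le_trans (h1 x) (ltW y1)].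
have i1 : nu.-integrable setT (EFin \o (cst 1 : R -> R)).
  apply: measurable_bounded_integrable => //.
  by exists 1; split; [exact: num_real|move=> y y1 x _; rewrite /= normr1 ltW].
have : (\int[nu]_x (1 + h x)%:E = 1)%E.
  rewrite (integral_spread_fold n).
  - under eq_integral => x _.
      rewrite sumEFin big_split/= h_bal addr0 sumr_const_nat subn0 natrX.
      over.
    rewrite integral_cst//= lebesgue_measure_itv/= lte_fin invr_gt0 exprn_gt0//.
    by rewrite oppr0 adde0 -EFinM divff// expf_neq0.
  - by apply/measurable_EFinP; exact: measurable_funD.
  - by move=> x; rewrite lee_fin; have := h1 x; rewrite ler_norml; lra.
under eq_integral do rewrite EFinD.
rewrite /Rintegral integralD//= integral_cst// spread_measureT mule1.
have := integrable_fin_num measurableT ih.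
by case: (\int[nu]_x _)%E => // r _; rewrite -EFinD => -[] /= ?; lra.
Qed.

(** [trig_parseval] for coefficient sequences with a single nonzero term. *)
Lemma sum_cis_freq n i k : (i < 2 ^ n)%N -> (k < 2 ^ n)%N ->
  \sum_(0 <= j < 2 ^ n)
    cis (freq e n i * node e n j : R) * (cis (freq e n k * node e n j))^* =
  2 ^+ n * (i == k)%:R :> R[i].
Proof.
move=> i_n kn; pose delta i j : R[i] := (i == j :> nat)%:R.
have trig_delta l j : (l < 2 ^ n)%N -> trig e n (delta l) j = cis (freq e n l * node e n j : R).
  move=> ln; rewrite /trig (bigD1_seq l) ?mem_index_iota ?iota_uniq//=.
  rewrite /delta eqxx mul1r big1 ?addr0// => m /negPf.
  by rewrite eq_sym => ->; rewrite mul0r.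
have := trig_parseval e_incr n (delta i) (delta k).
under eq_bigr do rewrite !trig_delta//.
move=> ->; congr (_ * _).
rewrite (bigD1_seq i) ?mem_index_iota ?iota_uniq//=.
rewrite [delta i i]/delta eqxx mul1r big1 ?addr0 => [|m /negPf].
  by rewrite /delta eq_sym; case: eqP => _; rewrite ?conjC1 ?conjC0.
by rewrite /delta eq_sym => ->; rewrite mul0r.
Qed.

Definition spectrum : set R :=
  [set l | exists n j, (j < 2 ^ n)%N /\ l = freq e n j].

Lemma freq_widen n m j : (n <= m)%N -> (j < 2 ^ n)%N ->
  freq e m j = freq e n j :> R.
Proof. exact: bitsum_widen. Qed.

Lemma measurable_Re_cis (l : R) :
  measurable_fun [set: R] (fun x : R => complex.Re (cis (l * x))).
Proof.
apply: (@measurableT_comp _ _ _ _ _ _ (@cos R)).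
  exact: continuous_measurable_fun (@continuous_cos R).
by apply: measurable_funM => //; apply: measurable_funM.
Qed.

Lemma measurable_Im_cis (l : R) :
  measurable_fun [set: R] (fun x : R => complex.Im (cis (l * x))).
Proof.
apply: (@measurableT_comp _ _ _ _ _ _ (@sin R)).
  exact: continuous_measurable_fun (@continuous_sin R).
by apply: measurable_funM => //; apply: measurable_funM.
Qed.

Lemma inL2_exponential (l : R) : inL2 nu (exponential l).
Proof.
have E : exponential l = fun x => cis (l * x).
  by apply/funext => x; exact: exponentialE.
split.
- by rewrite E; exact: measurable_Re_cis.
- by rewrite E; exact: measurable_Im_cis.
- rewrite L2normE; apply: poweR_lty; rewrite E.
  under eq_integral do rewrite sqmod_cis.
  by rewrite integral_cst// spread_measureT mule1 ltry.
Qed.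

Lemma L2inner_exponential (l m : R) :
  L2inner nu (exponential l) (exponential m) =
  ((\int[nu]_x complex.Re (cis ((l - m) * x))) +i*
   (\int[nu]_x complex.Im (cis ((l - m) * x))))%C.
Proof.
have E x : exponential l x * (exponential m x)^* = cis ((l - m) * x).
  by rewrite !exponentialE conj_cis -cisD -mulNr -mulrDl.
by rewrite /L2inner; congr (_ +i* _)%C; apply: eq_Rintegral => x _; rewrite E.
Qed.

(** The real and imaginary parts of the product of one exponential with the
    conjugate of another one sum to zero over the nodes of a common level, and
    so over all the translates of the nodes. *)
Lemma spectrum_orthonormal : orthonormal_family nu spectrum (@exponential R).
Proof.
split=> [l _|l m [n [i [i_n ->]]] [n' [k [kn ->]]]]; first exact: inL2_exponential.
pose N := maxn n n'.
rewrite -(freq_widen (leq_maxl n n') i_n) -(freq_widen (leq_maxr n n') kn) -/N.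
have {}i_n : (i < 2 ^ N)%N by rewrite (leq_trans i_n)// leq_exp2l// leq_maxl.
have {}kn : (k < 2 ^ N)%N by rewrite (leq_trans kn)// leq_exp2l// leq_maxr.
rewrite L2inner_exponential; case: eqVneq => [->|neq].
  rewrite subrr; under eq_Rintegral do rewrite mul0r cis0/=.
  under [X in (_ +i* X)%C]eq_Rintegral do rewrite mul0r cis0/=.
  by rewrite !Rintegral_cst//= spread_measureT/= !mulr1.
have ik : i != k by apply: contraNneq neq => ->.
have bal (x : R) : \sum_(0 <= j < 2 ^ N)
    cis ((freq e N i - freq e N k) * (node e N j + x)) = 0.
  have := sum_cis_freq i_n kn; rewrite (negPf ik) mulr0.
  move=> /(congr1 (fun z => z * cis ((freq e N i - freq e N k) * x))).
  rewrite mul0r mulr_suml => S0; rewrite -[RHS]S0; apply: eq_bigr => j _.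
  by rewrite conj_cis -!cisD; congr cis; ring.
have le1 (t x : R) :
    `|complex.Re (cis (t * x))| <= 1 /\ `|complex.Im (cis (t * x))| <= 1.
  by rewrite /= !ler_norml cos_geN1 cos_le1 sin_geN1 sin_le1.
have re0 : \int[nu]_x complex.Re (cis ((freq e N i - freq e N k) * x)) = 0.
  apply: (@Rintegral_balanced N) => [|x|x].
  - exact: measurable_Re_cis.
  - by have [] := le1 (freq e N i - freq e N k) x.
  - by rewrite -Re_sum bal.
have im0 : \int[nu]_x complex.Im (cis ((freq e N i - freq e N k) * x)) = 0.
  apply: (@Rintegral_balanced N) => [|x|x].
  - exact: measurable_Im_cis.
  - by have [] := le1 (freq e N i - freq e N k) x.
  - by rewrite -Im_sum bal.
by rewrite re0 im0.
Qed.

Lemma sqmod_parseval n (c : nat -> R[i]) :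
  \sum_(0 <= j < 2 ^ n) sqmod (trig e n c j) =
  2 ^+ n * \sum_(0 <= i < 2 ^ n) sqmod (c i).
Proof.
have := trig_parseval e_incr n c c.
under eq_bigr do rewrite mul_conj_sqmod.
under [in X in _ = X]eq_bigr do rewrite mul_conj_sqmod.
move=> /(congr1 (@complex.Re R)).
rewrite Re_sum => ->.
rewrite -(rmorph_sum (real_complex R)) -(rmorph1 (real_complex R)) -rmorphMn.
by rewrite -rmorphXn -rmorphM.
Qed.

(** Two equal frequencies would make the sum of [sum_cis_freq] equal to its
    number of terms instead of zero. *)
Lemma freq_inj n : {in gtn (2 ^ n)%N &, injective (freq e n : nat -> R)}.
Proof.
move=> i k /= i_n kn eq_ik; apply/eqP/negPn/negP => neq.
have := @sum_cis_freq n i k i_n kn; rewrite (negPf neq) mulr0 eq_ik.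
under eq_bigr do rewrite mul_cis_conj.
by rewrite sumr_const_nat subn0 => /eqP; rewrite pnatr_eq0 expn_eq0.
Qed.

(** The coefficients, indexed by [i] in the sum over one level, have to be
    reindexed by the frequencies. *)
Lemma trig_span n (c : nat -> R[i]) :
  exists (s : seq R) (c' : R -> R[i]), (forall l, l \in s -> spectrum l) /\
    forall y : R, \sum_(l <- s) c' l * exponential l y =
      \sum_(0 <= i < 2 ^ n) c i * cis (freq e n i * y).
Proof.
pose s : seq R := map (freq e n) (iota 0 (2 ^ n)).
have us : uniq s.
  rewrite map_inj_in_uniq ?iota_uniq// => i k.
  by rewrite !mem_iota !add0n/=; exact: freq_inj.
exists s, (fun l => c (index l s)); split.
  move=> l /mapP[k]; rewrite mem_iota add0n => /= k_n ->.
  by exists n, k.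
move=> y; rewrite big_map /index_iota subn0; apply: eq_big_seq => i.
rewrite mem_iota add0n /= => i_n; rewrite exponentialE; congr (c _ * _).
have := index_uniq (0 : R) _ us; rewrite size_map size_iota => /(_ _ i_n) {2}<-.
by congr index; rewrite (nth_map 0%N) ?size_iota// nth_iota.
Qed.

Lemma cis_near1 (th : R) : 0 < th ->
  exists2 d : R, 0 < d & forall x : R, 0 <= x < d -> sqmod (1 - cis x) < th.
Proof.
move=> th0.
have sE (x : R) : sqmod (1 - cis x) = 2 * (1 - cos (2 * pi * x)).
  rewrite /sqmod/= add0r.
  by have := cos2Dsin2 (2 * pi * x); nra.
have : {for 0, continuous (fun x : R => cos (2 * pi * x))}.
  apply: continuous_comp; last exact: continuous_cos.
  exact: mulrl_continuous.
have th2 : 0 < th / 2 by rewrite divr_gt0.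
move=> /cvgrPdist_lt/(_ _ th2) /nbhs_ballP[d /= d0 Hd]; exists d => // x /andP[x0 xd].
have : `|cos (2 * pi * 0) - cos (2 * pi * x)| < th / 2.
  by apply: Hd; rewrite /ball/= sub0r normrN ger0_norm.
rewrite mulr0 cos0 sE => /(le_lt_trans (ler_norm _)); lra.
Qed.

(** At the point of offset [x] in the [j]-th dyadic interval, the error splits
    into the variation of [F] and a sum at the [j]-th node whose coefficients are
    those of [c] damped by [1 - cis (freq * spread x)]. Applying Parseval to the
    damped sum, then to [c] itself, bounds its mean by [th * B] whatever the
    number of terms. *)
Lemma trig_approx n (F : R -> R[i]) (eta th B x : R) (c : nat -> R[i]) :
  0 <= x < 2 ^- n -> 0 <= th ->
  (forall j, (j < 2 ^ n)%N -> trig e n c j = F (dyadic n j)) ->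
  (forall y, sqmod (F y) <= B) ->
  (forall j, (j < 2 ^ n)%N -> sqmod (F (dyadic n j + x) - F (dyadic n j)) <= eta) ->
  (forall j, (j < 2 ^ n)%N -> sqmod (1 - cis (freq e n j * spread e x)) <= th) ->
  \sum_(0 <= j < 2 ^ n) sqmod (F (dyadic n j + x) -
     \sum_(0 <= i < 2 ^ n) c i * cis (freq e n i * spread e (dyadic n j + x)))
  <= 2 ^+ n * (2 * eta + 2 * (th * B)).
Proof.
move=> x0n th0 cF FB Feta cth.
pose c' i := c i * (1 - cis (freq e n i * spread e x)).
have step j : (j < 2 ^ n)%N -> sqmod (F (dyadic n j + x) -
     \sum_(0 <= i < 2 ^ n) c i * cis (freq e n i * spread e (dyadic n j + x))) <=
   2 * eta + 2 * sqmod (trig e n c' j).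
  move=> jn.
  rewrite [X in sqmod X](_ : _ = (F (dyadic n j + x) - F (dyadic n j)) + trig e n c' j).
    by rewrite (le_trans (sqmodD_le _ _))// lerD2r ler_pM2l// Feta.
  rewrite -cF// /trig -[RHS]addrA; congr (_ + _).
  rewrite addrC -sumrB -sumrN; apply: eq_big_nat => i _.
  by rewrite /c' spread_node// mulrDr cisD; ring.
apply: (@le_trans _ _ (\sum_(0 <= j < 2 ^ n) (2 * eta + 2 * sqmod (trig e n c' j)))).
  by apply: ler_sum_nat => j /andP[_ jn]; exact: step.
rewrite big_split/= sumr_const_nat subn0 -mulr_sumr sqmod_parseval.
rewrite mulrDr -[2 * eta *+ _]mulr_natl natrX lerD2l mulrCA !ler_pM2l ?exprn_gt0//.
apply: (@le_trans _ _ (th * \sum_(0 <= i < 2 ^ n) sqmod (c i))).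
  rewrite mulr_sumr; apply: ler_sum_nat => i /andP[_ i_n].
  by rewrite /c' sqmodM mulrC ler_wpM2r ?sqmod_ge0// cth.
apply: ler_wpM2l => //; rewrite -(@ler_pM2l _ (2 ^+ n)) ?exprn_gt0//.
rewrite -sqmod_parseval -natrX mulr_natl -[X in B *+ X]subn0 -sumr_const_nat.
by apply: ler_sum_nat => j /andP[_ jn]; rewrite cF.
Qed.

Lemma measurable_sqmod (f : R -> R[i]) :
  measurable_fun setT (fun x => complex.Re (f x)) ->
  measurable_fun setT (fun x => complex.Im (f x)) ->
  measurable_fun setT (fun x => sqmod (f x)).
Proof.
by move=> mr mi; apply: measurable_funD; apply: measurable_funX.
Qed.

Hypothesis e_gap : forall N, exists2 n, (N <= n)%N & (e n + N <= e n.+1)%N.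

Lemma measurable_trig_sum n (c : nat -> R[i]) :
  measurable_fun [set: R] (fun y : R => complex.Re
    (\sum_(0 <= i < 2 ^ n) c i * cis (freq e n i * y))) /\
  measurable_fun [set: R] (fun y : R => complex.Im
    (\sum_(0 <= i < 2 ^ n) c i * cis (freq e n i * y))).
Proof.
split; [under eq_fun do rewrite Re_sum|under eq_fun do rewrite Im_sum];
  apply: measurable_sum => i; move: (c i) => [a b];
  have mre := measurable_Re_cis (freq e n i);
  have mim := measurable_Im_cis (freq e n i).
- rewrite (_ : (fun _ => _) = fun y : R =>
      a * complex.Re (cis (freq e n i * y)) - b * complex.Im (cis (freq e n i * y)))//.
  by apply: measurable_funB; apply: measurable_funM.
- rewrite (_ : (fun _ => _) = fun y : R =>
      a * complex.Im (cis (freq e n i * y)) + b * complex.Re (cis (freq e n i * y)))//.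
  by apply: measurable_funD; apply: measurable_funM.
Qed.

Lemma expr2_div_gap_le a b N : (a + N <= b)%N -> 2 ^+ a * 2 ^- b <= 2 ^- N :> R.
Proof.
move=> ab; rewrite -ler_pdivlMl ?exprn_gt0// -invfM -exprD.
by rewrite lef_pV2 ?posrE ?exprn_gt0// ler_eXn2l ?ltr1n.
Qed.

(** At a level where the gap is long, the frequencies are at most
    [2 ^ (e n).+1] and the offsets at most [2 ^- (e n.+1)], so the products that
    enter [trig_approx] are close to zero. *)
Lemma trig_dense_continuous (f g : R -> R) (B delta : R) :
  continuous f -> continuous g -> 0 <= B ->
  (forall x, sqmod (f x +i* g x)%C <= B) -> 0 < delta ->
  exists n c, (\int[leb]_(x in `[0%R, 1%R[) (sqmod ((f x +i* g x)%C -
     \sum_(0 <= i < 2 ^ n) c i * cis (freq e n i * spread e x)))%:E < delta%:E)%E.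
Proof.
move=> cf cg B0 FB delta0; pose F x := (f x +i* g x)%C.
(* [trig_approx] bounds the error by [2 * eta + 2 * (th * B)]. *)
pose eta := delta / 8; have eta0 : 0 < eta by rewrite divr_gt0.
pose th := delta / 8 / (B + 1); have th0 : 0 < th by rewrite !divr_gt0// ltr_wpDl.
have thB : th * B <= delta / 8.
  rewrite /th mulrAC ler_pdivrMr ?ltr_wpDl// ler_wpM2l// ?ltW//; lra.
have se0 : 0 < Num.sqrt (eta / 2) by rewrite sqrtr_gt0 divr_gt0.
have cpt : compact (`[0, 1]%classic : set R) by exact: segment_compact.
have [d1 d10 H1] := compact_uniformly_continuous cpt cf se0.
have [d2 d20 H2] := compact_uniformly_continuous cpt cg se0.
have [d3 d30 H3] := cis_near1 th0.
pose d := Num.min d1 (Num.min d2 d3).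
have d0 : 0 < d by rewrite !lt_min d10 d20.
(* The length of the gap: then [2 * 2 ^- N] is below all three moduli. *)
pose N := (Num.trunc (2 / d)).+1.
have Nd : 2 * 2 ^- N < d.
  rewrite ltr_pdivrMr ?exprn_gt0// -ltr_pdivrMl// mulrC (lt_trans (truncnS_gt _))//.
  by rewrite -natrX ltr_nat ltn_expl.
have [dd1 dd2 dd3] : [/\ d <= d1, d <= d2 & d <= d3].
  by rewrite /d !ge_min !lexx !orbT.
have [n Nn gap] := e_gap N; pose m := n.+1.
have [c cF] := trig_interpolation e_incr m (F \o dyadic m).
have [mRe mIm] := measurable_trig_sum m c.
have ms : measurable_fun [set: R] (spread e : R -> R) by exact: measurable_spread.
have xd (x : R) : 0 <= x < 2 ^- m -> x < d.
  move=> /andP[x0 xm]; apply: lt_trans Nd; apply: lt_le_trans xm _.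
  apply: (@le_trans _ _ (2 ^- N)); last by rewrite ler_peMl ?invr_ge0 ?exprn_ge0// ler1n.
  by rewrite lef_pV2 ?posrE ?exprn_gt0// ler_eXn2l ?ltr1n// ltnW.
have bound (x : R) : 0 <= x < 2 ^- m ->
  \sum_(0 <= j < 2 ^ m) sqmod (F (dyadic m j + x) -
     \sum_(0 <= i < 2 ^ m) c i * cis (freq e m i * spread e (dyadic m j + x)))
  <= 2 ^+ m * (2 * eta + 2 * (th * B)).
  move=> xm; have /andP[x0 _] := xm; apply: trig_approx => //; first exact: ltW.
    move=> j jm; have ball_d : `|dyadic m j - (dyadic m j + x)| < d.
      by rewrite opprD addNKr normrN ger0_norm// xd.
    have xi01 : (`[0, 1]%classic : set R) (dyadic m j).
      have /andP[h1 h2] := dyadic_itv (R:=R) jm; rewrite /= in_itv/= h1 (le_trans h2)//.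
    have /ltW h1 := H1 _ _ xi01 (lt_le_trans ball_d dd1).
    have /ltW h2 := H2 _ _ xi01 (lt_le_trans ball_d dd2).
    have sq (y : R) : `|y| <= Num.sqrt (eta / 2) -> y ^+ 2 <= eta / 2.
      move=> hy; rewrite -[leRHS](sqr_sqrtr (ltW (divr_gt0 eta0 (ltr0Sn R 1)))).
      by rewrite -real_normK ?num_real// lerXn2r ?nnegrE// sqrtr_ge0.
    rewrite /sqmod /F/= (splitr eta) lerD// sq// distrC//.
  move=> j jm; apply/ltW/H3; have /andP[s0 sm] := spread_small e_incr xm.
  rewrite mulr_ge0 ?freq_ge0//=; apply: lt_le_trans dd3; apply: le_lt_trans Nd.
  apply: le_trans (ler_pM (freq_ge0 e m j) s0 (freq_le e_incr n j) sm) _.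
  rewrite /weight (exprS _ (e m)) invfM mulVKf ?pnatr_eq0// exprS -mulrA ler_pM2l//.
  exact: expr2_div_gap_le.
pose S (x : R) := \sum_(0 <= i < 2 ^ m) c i * cis (freq e m i * spread e x).
have mG : measurable_fun [set: R] (fun x => sqmod (F x - S x)).
  apply: measurable_sqmod.
  - rewrite (_ : (fun x => _) = fun x => f x - complex.Re (S x)); last first.
      by apply/funext => x; case: (S x).
    apply: measurable_funB; first exact: continuous_measurable_fun.
    exact: (measurableT_comp mRe ms).
  - rewrite (_ : (fun x => _) = fun x => g x - complex.Im (S x)); last first.
      by apply/funext => x; case: (S x).
    apply: measurable_funB; first exact: continuous_measurable_fun.
    exact: (measurableT_comp mIm ms).
exists m, c; rewrite (integral_fold m).
- apply: (@le_lt_trans _ _ (\int[leb]_(x in `[0%R, (2 ^- m)%R[)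
    (2 ^+ m * (2 * eta + 2 * (th * B)))%:E)%E).
    apply: ge0_le_integral => //.
    + by move=> x _; apply: sume_ge0 => j _; rewrite lee_fin sqmod_ge0.
    + apply: measurable_funTS; apply: emeasurable_sum => j.
      apply/measurable_EFinP; apply: (measurableT_comp mG).
      exact: measurable_funD.
    + move=> x; rewrite /= in_itv/= => xm; rewrite sumEFin lee_fin; exact: bound.
  rewrite integral_cst//= lebesgue_measure_itv/= lte_fin invr_gt0 exprn_gt0// oppr0 adde0.
  rewrite -EFinM lte_fin mulrAC divff ?expf_neq0// mul1r /eta; lra.
- exact/measurable_EFinP.
- by move=> x; rewrite lee_fin sqmod_ge0.
Qed.

(** A square integrable function becomes, through [spread], a square
    integrable function on [0, 1[, where continuous functions are dense. *)
Lemma spectrum_total : L2total nu spectrum (@exponential R).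
Proof.
move=> f L2f eps eps0; have := inL2_lty L2f; have [mRe mIm _] := L2f.
have ms : measurable_fun [set: R] (spread e : R -> R) by exact: measurable_spread.
rewrite integral_spread; last 2 first.
- by apply/measurable_EFinP; exact: measurable_sqmod.
- by move=> x; rewrite lee_fin sqmod_ge0.
pose u (x : R) := complex.Re (f (spread e x)); pose v (x : R) := complex.Im (f (spread e x)).
have mu : measurable_fun setT u by exact: (measurableT_comp mRe).
have mv : measurable_fun setT v by exact: (measurableT_comp mIm).
have mI : measurable (`[0%R, 1%R[%classic : set R) by exact: measurable_itv.
move=> fin.
have u2 : (\int[leb]_(x in `[0%R, 1%R[) (u x ^+ 2)%:E < +oo)%E.
  apply: le_lt_trans fin; apply: ge0_le_integral => //.
  - by move=> x _; rewrite lee_fin sqr_ge0.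
  - by apply/measurable_EFinP; apply: measurable_funTS; exact: measurable_funX.
  - apply/measurable_EFinP; apply: measurable_funTS.
    by apply: (measurable_sqmod (f := f \o spread e)).
  - by move=> x _; rewrite lee_fin lerDl sqr_ge0.
have v2 : (\int[leb]_(x in `[0%R, 1%R[) (v x ^+ 2)%:E < +oo)%E.
  apply: le_lt_trans fin; apply: ge0_le_integral => //.
  - by move=> x _; rewrite lee_fin sqr_ge0.
  - by apply/measurable_EFinP; apply: measurable_funTS; exact: measurable_funX.
  - apply/measurable_EFinP; apply: measurable_funTS.
    by apply: (measurable_sqmod (f := f \o spread e)).
  - by move=> x _; rewrite lee_fin lerDr sqr_ge0.
have d0 : 0 < eps ^+ 2 / 16 by rewrite divr_gt0// exprn_gt0.
have d1 : 0 < eps ^+ 2 / 4 by rewrite divr_gt0// exprn_gt0.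
have [g [M [cg gM ug]]] := continuous_dense_L2 mu u2 d0.
have [h [M' [ch hM vh]]] := continuous_dense_L2 mv v2 d0.
have mg : measurable_fun [set: R] g by exact: continuous_measurable_fun.
have mh : measurable_fun [set: R] h by exact: continuous_measurable_fun.
have ghB x : sqmod (g x +i* h x)%C <= M ^+ 2 + M' ^+ 2.
  rewrite /sqmod/= -[leLHS]/(g x ^+ 2 + h x ^+ 2).
  rewrite -(real_normK (num_real (g x))) -(real_normK (num_real (h x))).
  have M0 := le_trans (normr_ge0 _) (gM x); have M'0 := le_trans (normr_ge0 _) (hM x).
  by rewrite lerD// lerXn2r ?nnegrE.
have B0 : 0 <= M ^+ 2 + M' ^+ 2 by rewrite addr_ge0 ?sqr_ge0.
have [n [c gc]] := trig_dense_continuous cg ch B0 ghB d1.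
have [s [c' [s_spec cE]]] := trig_span n c.
exists s, c'; split => //.
pose T (y : R) := \sum_(0 <= i < 2 ^ n) c i * cis (freq e n i * y).
have [mTr mTi] := measurable_trig_sum n c; rewrite -/(T _) in mTr mTi.
have mTsr : measurable_fun [set: R] (fun x => complex.Re (T (spread e x))).
  exact: (measurableT_comp mTr ms).
have mTsi : measurable_fun [set: R] (fun x => complex.Im (T (spread e x))).
  exact: (measurableT_comp mTi ms).
have mB (a b : R -> R[i]) :
    measurable_fun setT (fun x => complex.Re (a x)) ->
    measurable_fun setT (fun x => complex.Im (a x)) ->
    measurable_fun setT (fun x => complex.Re (b x)) ->
    measurable_fun setT (fun x => complex.Im (b x)) ->
    measurable_fun setT (fun x => sqmod (a x - b x)).
  move=> mar mai mbr mbi; apply: measurable_sqmod.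
  - rewrite (_ : (fun x => _) = fun x => complex.Re (a x) - complex.Re (b x)).
      exact: measurable_funB.
    by apply/funext => x; case: (a x) (b x) => ? ? [].
  - rewrite (_ : (fun x => _) = fun x => complex.Im (a x) - complex.Im (b x)).
      exact: measurable_funB.
    by apply/funext => x; case: (a x) (b x) => ? ? [].
apply: L2norm_lt => //.
have -> : (fun x => (sqmod (f x - \sum_(l <- s) c' l * exponential l x))%:E) =
    (fun x => (sqmod (f x - T x))%:E).
  by apply/funext => x; rewrite cE.
rewrite integral_spread; last 2 first.
- by apply/measurable_EFinP; exact: mB.
- by move=> x; rewrite lee_fin sqmod_ge0.
rewrite (_ : eps ^+ 2 =
  2 * (2 * (eps ^+ 2 / 16) + 2 * (eps ^+ 2 / 16)) + 2 * (eps ^+ 2 / 4)); last by field.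
apply: (integral_lt_2D (f := fun x => sqmod ((u x - g x) +i* (v x - h x))%C)
  (g := fun x => sqmod ((g x +i* h x)%C - T (spread e x)))) => //;
  try by move=> x; exact: sqmod_ge0.
- by apply: measurable_sqmod => /=; exact: measurable_funB.
- exact: (mB (fun x => (g x +i* h x)%C)).
- exact: (mB (f \o spread e) (T \o spread e)).
- move=> x _; rewrite (_ : f (spread e x) - T (spread e x) =
      ((u x - g x) +i* (v x - h x))%C + ((g x +i* h x)%C - T (spread e x))).
    exact: sqmodD_le.
  rewrite /u /v; case: (f _) (T _) => a1 b1 [a2 b2]; simpc => /=.
  by congr (_ +i* _)%C; ring.
apply: (integral_lt_2D (f := fun x => (u x - g x) ^+ 2)
  (g := fun x => (v x - h x) ^+ 2)) => //; try by move=> x; exact: sqr_ge0.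
- by apply: measurable_funX; exact: measurable_funB.
- by apply: measurable_funX; exact: measurable_funB.
- by apply: measurable_sqmod => /=; exact: measurable_funB.
- by move=> x; exact: sqmod_ge0.
- move=> x _; rewrite /sqmod/= -[leLHS]/((u x - g x) ^+ 2 + (v x - h x) ^+ 2).
  by rewrite lerD// ler_peMl ?sqr_ge0// ler1n.
Qed.

Lemma spectral_spread_measure : spectral_measure nu.
Proof.
split; first exact: spread_measureT.
by exists spectrum; split; [exact: spectrum_orthonormal|exact: spectrum_total].
Qed.

End spread_measure.

(** * Hausdorff and packing dimensions of sets *)

Section diameter_facts.
Context {R : realType}.
Implicit Types (U V E : set R) (t r : R).

Lemma diameter_ge0 U : (0 <= diameter U)%E.
Proof. by apply: ereal_sup_ubound; left. Qed.

Lemma diameter_ge U x y : U x -> U y -> (`|x - y|%:E <= diameter U)%E.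
Proof. by move=> Ux Uy; apply: ereal_sup_ubound; right; exists x => //; exists y. Qed.

Lemma diameter_le U r : 0 <= r -> (forall x y, U x -> U y -> `|x - y| <= r) ->
  (diameter U <= r%:E)%E.
Proof.
move=> r0 H; apply: ge_ereal_sup => _ [->|[x Ux [y Uy <-]]].
  by rewrite lee_fin.
by rewrite lee_fin H.
Qed.

Lemma diameter_closed_ball (x : R) r : 0 < r -> diameter (closed_ball x r) = (2 * r)%:E.
Proof.
move=> r0; rewrite closed_ball_itv//; apply/eqP; rewrite eq_le; apply/andP; split.
  apply: diameter_le; first by rewrite mulr_ge0// ltW.
  move=> y z /=; rewrite !in_itv/= => /andP[? ?] /andP[? ?].
  by rewrite ler_norml; apply/andP; split; lra.
have <- : `|(x + r) - (x - r)| = 2 * r.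
  by rewrite opprB addrC addrA subrK ger0_norm; lra.
by apply: diameter_ge; rewrite /= in_itv/= lexx; apply/andP; split; lra.
Qed.

Lemma diam_pow_ge0 t U : (0 <= diam_pow t U)%E.
Proof. by rewrite /diam_pow; case: ifP => // _; exact: poweR_ge0. Qed.

Lemma diam_pow_closed_ball t (x : R) r : 0 < r ->
  diam_pow t (closed_ball x r) = ((2 * r) `^ t)%:E.
Proof.
move=> r0; rewrite /diam_pow diameter_closed_ball// ifF ?poweR_EFin//.
by apply/negP => /eqP/seteqP[/(_ x) H _]; apply: H; exact: closed_ballxx.
Qed.

Lemma diam_pow_le t U r : 0 <= t -> 0 <= r -> (diameter U <= r%:E)%E ->
  (diam_pow t U <= (r `^ t)%:E)%E.
Proof.
move=> t0 r0 Ur; rewrite /diam_pow; case: ifP => _; first by rewrite lee_fin powR_ge0.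
rewrite -poweR_EFin gt0_ler_poweR// ?in_itv/= ?leey ?diameter_ge0// andbT.
by rewrite lee_fin.
Qed.

End diameter_facts.

Section hausdorff_le_packing.
Context {R : realType}.
Implicit Types (U V E F : set R) (t r delta : R).

Lemma packing_pre_delta_ge t delta F D (x r : nat -> R) : packing delta F D x r ->
  (\esum_(n in D) diam_pow t (closed_ball (x n) (r n)) <= packing_pre_delta t delta F)%E.
Proof. by move=> p; apply: ereal_sup_ubound; exists D, x, r. Qed.

Lemma packing_pre_delta_ge0 t delta F : (0 <= packing_pre_delta t delta F)%E.
Proof.
have p0 : packing delta F set0 (fun=> 0) (fun=> 0) by split=> // i j [].
by have := packing_pre_delta_ge t p0; rewrite esum_set0.
Qed.

Lemma packing_pre_ge0 t F : (0 <= packing_pre t F)%E.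
Proof. by apply: le_ereal_inf_tmp => _ [d _ <-]; exact: packing_pre_delta_ge0. Qed.

Lemma le_packing_pre_delta t delta1 delta2 F : delta1 <= delta2 ->
  (packing_pre_delta t delta1 F <= packing_pre_delta t delta2 F)%E.
Proof.
move=> d12; apply: ge_ereal_sup => _ [D [x [r [[p1 p2] ->]]]].
apply: packing_pre_delta_ge; split=> // n /p1[? ? rn]; split => //.
exact: le_trans d12.
Qed.

Definition cell r (F : set R) (j : int) : set R :=
  F `&` [set y | j%:~R * (2 * r) <= y < (j + 1)%:~R * (2 * r)].

Lemma cell_dist r F j y z : cell r F j y -> cell r F j z -> `|y - z| <= 2 * r.
Proof.
move=> [_ /=] /andP[y1 y2] [_ /=] /andP[z1 z2]; move: y2 z2.
rewrite rmorphD/= mulrDl mul1r => y2 z2.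
by rewrite ler_norml; apply/andP; split; lra.
Qed.

Lemma cell_cover r F y : 0 < r -> F y -> exists j, cell r F j y.
Proof.
move=> r0 Fy; exists (Num.floor (y / (2 * r))); split => //=.
have r2 : 0 < 2 * r by rewrite mulr_gt0.
by rewrite -ler_pdivlMr// -ltr_pdivrMr// floor_itv.
Qed.

Lemma cell_apart r F (b : bool) (j k : int) y z : 0 < r -> j != k ->
  odd `|j| = b -> odd `|k| = b -> cell r F j y -> cell r F k z ->
  2 * r < `|y - z|.
Proof.
move=> r0 jk jb kb; wlog ltjk : j k y z jk jb kb / (j < k)%R => [H cy cz|].
  case/orP: (lt_total jk) => h; first exact: (H j k).
  by rewrite distrC; apply: (H k j) => //; rewrite eq_sym.
have {ltjk} le2 : (j + 2 <= k)%R by move: jb kb ltjk; clear; lia.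
move=> [_ /=] /andP[y1 y2] [_ /=] /andP[z1 z2].
have r2 : 0 < 2 * r by rewrite mulr_gt0.
have : (j + 2)%:~R * (2 * r) <= k%:~R * (2 * r) by rewrite ler_pM2r// ler_int.
move: y2; rewrite !rmorphD/= !mulrDl mul1r => y2 h.
by rewrite distrC (lt_le_trans _ (ler_norm _))//; lra.
Qed.

(** In each nonempty cell of a grid of mesh [2 * r] choose a point of [F]. The
    points in the cells whose index has a given parity are more than [2 * r]
    apart, so the balls of radius [r] around them are a packing, and those balls
    have at least the diameter of the cells. The two parities account for the
    factor 2. *)
Lemma grid_cover t r F : 0 <= t -> 0 < r ->
  exists U : nat -> set R, [/\ forall m, (diameter (U m) <= (2 * r)%:E)%E,
    F `<=` \bigcup_m U m &
    (\sum_(m <oo) diam_pow t (U m) <= 2%:E * packing_pre_delta t r F)%E].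
Proof.
move=> t0 r0; have r2 : 0 <= 2 * r by rewrite mulr_ge0// ltW.
(* The cells are indexed by the integers, and a cover by the natural numbers. *)
pose U m := \bigcup_(j in [set j : int | pickle j = m]) cell r F j.
pose D b := [set m | exists j : int,
  [/\ pickle j = m, odd `|j| = b & cell r F j !=set0]].
have pickle_inj : injective (pickle : int -> nat) := pcan_inj pickleK.
have UE j : U (pickle j) = cell r F j.
  apply/seteqP; split => [y [k /= /pickle_inj <-]//|y Uy].
  by exists j.
have Udiam m : (diameter (U m) <= (2 * r)%:E)%E.
  apply: diameter_le => // y z [j /= <- cy] [k /= /pickle_inj -> cz].
  exact: cell_dist cy cz.
exists U; split => //.
  move=> y Fy; have [j jy] := cell_cover r0 Fy.
  by exists (pickle j) => //; rewrite UE.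
(* The chosen point; the default value only occurs for empty cells. *)
pose x m := xget 0 (U m).
have Ux m : U m !=set0 -> U m (x m) by move=> [y Uy]; exact: xgetPex (ex_intro _ y Uy).
have Dpack b : packing r F (D b) x (fun=> r).
  split=> [m [j [<- _ c0]]|m n [j [<- jb cj0]] [k [<- kb ck0]]].
    split => //; have := Ux (pickle j); rewrite UE => /(_ c0).
    by case.
  rewrite !closed_ball_itv// => -[y [/=]]; rewrite !in_itv/= => /andP[y1 y2] /andP[y3 y4].
  congr pickle; apply/eqP/negPn/negP => jk.
  have xj := Ux (pickle j); rewrite UE in xj; have {xj} := xj cj0.
  have xk := Ux (pickle k); rewrite UE in xk; have {xk} := xk ck0.
  move=> xk xj; have := cell_apart r0 jk jb kb xj xk.
  by rewrite ltNge ler_norml => /negP; apply; apply/andP; split; lra.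
pose c : \bar R := ((2 * r) `^ t)%:E.
pose a b m := if m \in D b then c else 0%E.
have c0 : (0 <= c)%E by rewrite lee_fin powR_ge0.
have a0 b m : (0 <= a b m)%E by rewrite /a; case: ifP.
have suma b : (\sum_(m <oo) a b m <= packing_pre_delta t r F)%E.
  rewrite nneseries_esumT//; have := packing_pre_delta_ge t (Dpack b).
  rewrite esum_mkcond; apply: le_trans; apply: le_esum => m _.
  by rewrite /a; case: ifP => // _; rewrite diam_pow_closed_ball.
apply: (@le_trans _ _ (\sum_(m <oo) (a true m + a false m))%E).
  apply: lee_nneseries => [m _ _|m _]; first exact: diam_pow_ge0.
  have [[j [jm c_j]]|H] := pselect (exists j : int, pickle j = m /\ cell r F j !=set0).
    have ac : a (odd `|j|) m = c by rewrite /a ifT// inE; exists j.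
    have am : (c <= a true m + a false m)%E.
      by case: (odd _) ac => ->; [rewrite leeDl|rewrite leeDr].
    by apply: le_trans am; apply: diam_pow_le.
  rewrite (_ : U m = set0) ?/diam_pow ?eqxx ?adde_ge0//.
  apply/seteqP; split => // y [j /= jm cy]; apply: H; exists j; split => //.
  by exists y.
rewrite nneseriesD//; apply: (le_trans (leeD (suma true) (suma false))).
by rewrite -[2]/(1 + 1)%R EFinD ge0_muleDl// ?mul1e.
Qed.

(** Cover the set by pieces whose packing premeasures have a small sum, then
    each piece by a grid fine enough for its own premeasure. *)
Lemma packing_measure_eq0_hausdorff t E : 0 <= t ->
  packing_measure t E = 0%E -> hausdorff_measure t E = 0%E.
Proof.
move=> t0 pm0; apply/eqP; rewrite eq_le; apply/andP; split; last first.
  apply: (@le_trans _ _ (hausdorff_pre t 1 E)).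
    apply: le_ereal_inf_tmp => _ [U _ <-]; apply: nneseries_ge0 => n _ _.
    exact: diam_pow_ge0.
  by apply: ereal_sup_ubound; exists 1 => //=.
apply: ge_ereal_sup => _ [delta /= delta0 <-].
apply/lee_addgt0Pr => eps eps0; rewrite add0e.
have eps4 : 0 < eps / 4 by rewrite divr_gt0.
have : (packing_measure t E < (eps / 4)%:E)%E by rewrite pm0 lte_fin.
move=> /ereal_inf_lt[_ [F EF <-] sumF].
have Ffin n : packing_pre t (F n) \is a fin_num.
  rewrite ge0_fin_numE ?packing_pre_ge0//.
  apply: le_lt_trans (ltry (eps / 4)); apply: le_trans (ltW sumF).
  have := @nneseries_lim_ge R (fun n => packing_pre t (F n)) xpredT 0 n.+1.
  move=> /(_ (fun n _ _ => packing_pre_ge0 t (F n))); apply: le_trans.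
  rewrite big_nat_recr//= leeDr// sume_ge0// => i _; exact: packing_pre_ge0.
have ex n : exists U : nat -> set R, [/\ forall m, (diameter (U m) <= delta%:E)%E,
    F n `<=` \bigcup_m U m &
    (\sum_(m <oo) diam_pow t (U m) <=
     2%:E * (packing_pre t (F n) + (eps / 4 / (2 ^ n.+1)%:R)%:E))%E].
  have e0 : 0 < eps / 4 / (2 ^ n.+1)%:R by rewrite divr_gt0// ltr0n expn_gt0.
  have [_ [d /= d0 <-] dlt] := lb_ereal_inf_adherent e0 (Ffin n).
  pose r := Num.min d (delta / 2).
  have r0 : 0 < r by rewrite lt_min d0 divr_gt0.
  have [U [U1 U2 U3]] := grid_cover (F n) t0 r0; exists U; split => //.
    move=> m; apply: le_trans (U1 m) _; rewrite lee_fin -ler_pdivlMl//.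
    by rewrite mulrC ge_min lexx orbT.
  apply: (le_trans U3); rewrite lee_pmul2l//; apply: le_trans (ltW dlt).
  by apply: le_packing_pre_delta; rewrite ge_min lexx.
have [U HU] := choice ex.
have /card_set_bijP[f fbij] : ([set: nat] #= [set: nat * nat])%card.
  by rewrite card_eq_sym; exact: card_nat2.
apply: (@le_trans _ _ (\sum_(k <oo) diam_pow t (U (f k).1 (f k).2))%E).
  apply: ereal_inf_lbound; exists (fun k => U (f k).1 (f k).2) => //; split.
    by move=> k; have [] := HU (f k).1.
  move=> y /EF[n _ Fy]; have [_ /(_ y Fy)[m _ Uy] _] := HU n.
  have [_ _ /(_ (n, m) I)[k _ fk]] := fbij.
  by exists k => //; rewrite fk.
rewrite nneseries_esumT; last by move=> k; exact: diam_pow_ge0.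
rewrite -(reindex_esum _ _ _ (fun p => diam_pow t (U p.1 p.2)) fbij).
have -> : [set: nat * nat] = [set: nat] `*`` (fun=> [set: nat]).
  by apply/seteqP; split.
rewrite -(esum_esum (a := fun n m => diam_pow t (U n m))); last first.
  by move=> *; exact: diam_pow_ge0.
rewrite -nneseries_esumT; last first.
  by move=> n; apply: esum_ge0 => m _; exact: diam_pow_ge0.
apply: (@le_trans _ _ (\sum_(n <oo)
    2%:E * (packing_pre t (F n) + (eps / 4 / (2 ^ n.+1)%:R)%:E))%E).
  apply: lee_nneseries => [n _ _|n _].
    by apply: esum_ge0 => m _; exact: diam_pow_ge0.
  rewrite -nneseries_esumT; last by move=> m; exact: diam_pow_ge0.
  by have [] := HU n.
rewrite nneseriesZl; last first.
  by move=> n _; rewrite adde_ge0 ?packing_pre_ge0// lee_fin divr_ge0// ltW.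
apply: (@le_trans _ _ (2%:E * (eps / 4 + eps / 4)%:E)%E); last first.
  by rewrite -EFinM lee_fin; lra.
rewrite lee_pmul2l//.
apply: le_trans
  (@epsilon_trick R (fun n => packing_pre t (F n)) (eps / 4) xpredT _ (ltW eps4)) _.
  by move=> n; exact: packing_pre_ge0.
by rewrite EFinD leeD2r// ltW.
Qed.

Lemma dimH_le_dimP E : (dimH E <= dimP E)%E.
Proof.
apply: le_ereal_inf => _ [t [t0 tE] <-]; exists t => //; split => //.
exact: packing_measure_eq0_hausdorff.
Qed.

End hausdorff_le_packing.

(** * Dimensions of the measure *)

Section lower_dimension.
Context {R : realType}.
Variable e : nat -> nat.
Hypothesis e_incr : forall n, (e n < e n.+1)%N.
Local Notation leb := (@lebesgue_measure R).
Local Notation nu := (@spread_measure R e e_incr).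

Lemma spread_measure_lebesgue (A : set R) : measurable A ->
  nu A = leb ((spread e @^-1` A) `&` `[0, 1[%classic).
Proof.
move=> mA; have ms : measurable_fun [set: R] (spread e : R -> R) by exact: measurable_spread.
have mpA : measurable ((spread e : R -> R) @^-1` A).
  by rewrite -[X in measurable X]setTI; exact: ms.
transitivity (\int[nu]_x (\1_A x)%:E)%E; first by rewrite integral_indic// setIT.
rewrite integral_spread.
- by rewrite -[RHS](@integral_indic _ _ _ leb).
- by apply/measurable_EFinP; exact: measurable_indic.
- by move=> x; rewrite lee_fin.
Qed.

(** A cover of [E] pulls back through [spread] to a cover of its preimage by
    sets whose diameters are at most [C] times the [t]-th powers of the original
    ones; such sets need not be measurable, but they are contained in intervals
    of twice that length. *)
Lemma hausdorff_measure_eq0_null t (C : R) (E : set R) : 0 <= t -> 0 <= C ->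
  (forall x y : R, 0 <= x < 1 -> 0 <= y < 1 ->
    `|x - y| <= C * `|spread e x - spread e y| `^ t) ->
  measurable E -> hausdorff_measure t E = 0%E -> nu E = 0%E.
Proof.
move=> t0 C0 hold mE HE; apply/eqP; rewrite eq_le measure_ge0 andbT.
apply/lee_addgt0Pr => eps eps0; rewrite add0e.
(* The summand 1 only serves to divide by a positive number. *)
have d0 : 0 < eps / (2 * C + 1) by rewrite divr_gt0// ltr_wpDl// mulr_ge0.
have : (hausdorff_pre t 1 E < (eps / (2 * C + 1))%:E)%E.
  apply: (@le_lt_trans _ _ 0%E); last by rewrite lte_fin.
  by rewrite -HE; apply: ereal_sup_ubound; exists 1 => //=.
move=> /ereal_inf_lt[_ [U [Udiam EU] <-] sumU].
pose V n := [set x | 0 <= x < 1 /\ U n (spread e x)].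
pose d n := fine (diameter (U n)).
have dE n : diameter (U n) = (d n)%:E.
  rewrite fineK// ge0_fin_numE ?diameter_ge0//.
  by rewrite (le_lt_trans (Udiam n))// ltry.
pose c n := C * d n `^ t.
have c0 n : 0 <= c n by rewrite mulr_ge0// powR_ge0.
pose J n := if pselect (V n !=set0) is left h
  then `[projT1 (cid h) - c n, projT1 (cid h) + c n]%classic else set0.
have VJ n : V n `<=` J n.
  rewrite /J; case: pselect => [h|h] x Vx; last by apply: h; exists x.
  case: (cid h) => v [v01 Uv] /=; have [x01 Ux] := Vx.
  have h1 : `|x - v| <= c n.
    rewrite (le_trans (hold _ _ x01 v01))// ler_wpM2l// ge0_ler_powR ?nnegrE//.
      by rewrite -lee_fin -dE diameter_ge0.
    by rewrite -lee_fin -dE; exact: diameter_ge.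
  by move: h1; rewrite in_itv/= ler_norml => /andP[? ?]; apply/andP; split; lra.
have mJ n : measurable (J n) by rewrite /J; case: pselect => // h; exact: measurable_itv.
have lJ n : (leb (J n) <= (2 * C)%:E * diam_pow t (U n))%E.
  rewrite /J; case: pselect => [h|h]; last first.
    by rewrite measure0 mule_ge0 ?diam_pow_ge0// lee_fin mulr_ge0.
  have [x [_ Ux]] := h; rewrite /diam_pow ifF; last first.
    by apply/negP => /eqP U0; rewrite U0 in Ux.
  rewrite dE poweR_EFin -EFinM lebesgue_measure_itv/= lte_fin.
  case: ifP => _; last by rewrite lee_fin !mulr_ge0// powR_ge0.
  by rewrite -EFinB lee_fin -mulrA -/(c n); lra.
rewrite spread_measure_lebesgue//.
apply: (@le_trans _ _ (\sum_(n <oo) leb (J n))%E).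
  apply: measure_sigma_subadditive => //.
    apply: measurableI => //; rewrite -[X in measurable X]setTI.
    exact: (measurable_spread e_incr).
  move=> x [/= Ex]; rewrite in_itv/= => x01; have [n _ Un] := EU _ Ex.
  by exists n => //; exact: VJ.
apply: (@le_trans _ _ (\sum_(n <oo) (2 * C)%:E * diam_pow t (U n))%E).
  by apply: lee_nneseries => [n _ _|n _]; [exact: measure_ge0|exact: lJ].
rewrite nneseriesZl; last by move=> n _; exact: diam_pow_ge0.
apply: (@le_trans _ _ ((2 * C)%:E * (eps / (2 * C + 1))%:E)%E).
  by apply: lee_wpmul2l; [rewrite lee_fin mulr_ge0|exact: ltW].
rewrite -EFinM lee_fin mulrCA -[leRHS]mulr1 ler_wpM2l ?ltW//.
by rewrite ltr_pdivrMr ?mul1r ?ltrDl// ltr_wpDl// mulr_ge0.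
Qed.

Lemma dimH_ge_spread (s : R) :
  (forall t, 0 <= t < s -> exists2 C : R, 0 < C & forall m, 2 ^- m <= C * weight e m `^ t) ->
  forall E, measurable E -> (0 < nu E)%E -> (s%:E <= dimH E)%E.
Proof.
move=> Hs E mE E0; apply: le_ereal_inf_tmp => _ [t [t0 HE] <-].
rewrite lee_fin leNgt; apply/negP => ts.
have [|C C0 HC] := Hs t; first by rewrite t0.
have hold := spread_inverse_hoelder e_incr t0 (ltW C0) HC.
move: E0; rewrite (hausdorff_measure_eq0_null t0 _ hold mE HE) ?ltxx//.
by rewrite mulr_ge0// ltW.
Qed.

End lower_dimension.

Section upper_dimension.
Context {R : realType}.
Variable e : nat -> nat.
Hypothesis e_incr : forall n, (e n < e n.+1)%N.
Local Notation leb := (@lebesgue_measure R).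
Local Notation w := (@weight R e).
Local Notation nu := (@spread_measure R e e_incr).

(** The points that, at each level, lie in one of the intervals which the first
    digits allow. This set contains the image of [0, 1[ and is visibly
    measurable. *)
Definition carrier : set R :=
  \bigcap_n \bigcup_(j in [set j | (j < 2 ^ n)%N])
    `[node e n j, node e n j + 2 * w n]%classic.

Lemma measurable_carrier : measurable carrier.
Proof.
apply: bigcapT_measurable => n; apply: bigcup_measurable => j _.
exact: measurable_itv.
Qed.

Lemma spread_cylinder n j (x : R) : (j < 2 ^ n)%N ->
  dyadic n j <= x < dyadic n j + 2 ^- n ->
  node e n j <= spread e x <= node e n j + 2 * w n.
Proof.
move=> jn /andP[x1 x2].
have x0n : 0 <= x - dyadic n j < 2 ^- n by rewrite subr_ge0 x1/= ltrBlDl.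
have -> : x = dyadic n j + (x - dyadic n j) by rewrite addrC subrK.
rewrite spread_node// lerDl lerD2l.
by have /andP[-> ->] := spread_small e_incr x0n.
Qed.

Lemma spread_carrier (x : R) : 0 <= x < 1 -> carrier (spread e x).
Proof.
move=> x01 n _; have [j jn xj] := dyadic_locate n x01.
by exists j => //=; rewrite in_itv/=; exact: spread_cylinder.
Qed.

Lemma spread_measure_carrier : nu carrier = 1%E.
Proof.
rewrite (spread_measure_lebesgue e_incr); last exact: measurable_carrier.
have -> : (spread e @^-1` carrier) `&` `[0, 1[%classic = (`[0, 1[%classic : set R).
  apply/seteqP; split => [x [_ ?]//|x]; rewrite /= in_itv/= => x01.
  by split => //; exact: spread_carrier.
by rewrite lebesgue_measure_itv/= lte_fin ltr01 oppr0 adde0.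
Qed.

(** The ball contains the image of a whole dyadic interval of level [n]. *)
Lemma spread_measure_ball n (y r : R) : carrier y -> 2 * w n <= r ->
  ((2 ^- n)%:E <= nu (closed_ball y r))%E.
Proof.
move=> /(_ n I)[j /= jn]; rewrite in_itv/= => /andP[y1 y2] wr.
have r0 : 0 < r by rewrite (lt_le_trans _ wr)// mulr_gt0// weight_gt0.
have p0 : 0 < 2 ^- n :> R by rewrite invr_gt0 exprn_gt0.
have <- : leb `[dyadic n j, dyadic n j + 2 ^- n[%classic = (2 ^- n)%:E.
  rewrite lebesgue_measure_itv/= lte_fin ltrDl p0 -EFinB; congr EFin; lra.
rewrite (spread_measure_lebesgue e_incr); last exact: measurable_closed_ball.
apply: le_measure; rewrite ?inE//.
  apply: measurableI => //; rewrite -[X in measurable X]setTI.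
  apply: (measurable_spread e_incr) => //; exact: measurable_closed_ball.
move=> x; rewrite /= !in_itv/= => xj; split.
  rewrite closed_ball_itv//= in_itv/=.
  by have /andP[? ?] := spread_cylinder jn xj; apply/andP; split; lra.
have /andP[h1 h2] := dyadic_itv (R:=R) jn; move: xj => /andP[x1 x2].
by apply/andP; split; lra.
Qed.

Lemma weight_nonincreasing m n : (m <= n)%N -> w n <= w m.
Proof.
move=> mn; rewrite /weight lef_pV2 ?posrE ?exprn_gt0// ler_eXn2l ?ltr1n// ltnS.
exact: e_nondecreasing.
Qed.

Lemma weight_lt_eventually (r : R) : 0 < r -> exists k, 2 * w k <= r.
Proof.
move=> r0; pose k := (Num.trunc r^-1).+1.
have ek : (k <= e k)%N.
  elim: k => [//|k IH]; exact: leq_ltn_trans IH (e_incr k).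
exists k; rewrite /weight exprS invfM mulVKf ?pnatr_eq0//.
rewrite -[leRHS]invrK lef_pV2 ?posrE ?invr_gt0 ?exprn_gt0//.
rewrite (le_trans (ltW (truncnS_gt _)))// -natrX ler_nat -/k.
by rewrite (leq_trans ek)// ltnW// ltn_expl.
Qed.

(** Comparing the radius of each ball of a packing with the weights bounds the
    [t]-th power of its diameter by [eps] times its mass; the balls are disjoint
    and the total mass is one. *)
Lemma packing_pre_carrier t : 0 <= t ->
  (forall eps : R, 0 < eps -> exists M, forall m, (M <= m)%N ->
    (4 * w m) `^ t <= eps * 2 ^- m.+1) ->
  packing_pre t carrier = 0%E.
Proof.
move=> t0 Ht; apply/eqP; rewrite eq_le packing_pre_ge0 andbT.
apply/lee_addgt0Pr => eps eps0; rewrite add0e; have [M HM] := Ht _ eps0.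
have wM := weight_gt0 (R:=R) e M.
apply: (@le_trans _ _ (packing_pre_delta t (w M) carrier)).
  by apply: ereal_inf_lbound; exists (w M).
apply: ge_ereal_sup => _ [D [x [r [[pD tD] ->]]]].
have step n : D n -> (diam_pow t (closed_ball (x n) (r n)) <=
    eps%:E * nu (closed_ball (x n) (r n)))%E.
  move=> /pD[Kx r0 rM]; rewrite diam_pow_closed_ball//.
  have := weight_lt_eventually r0 => /ex_minnP[[|m] km mmin].
    exfalso; have := weight_nonincreasing (leq0n M); have := weight_gt0 (R:=R) e 0%N; lra.
  have Mm : (M <= m)%N.
    rewrite leqNgt; apply/negP => mM; have := weight_nonincreasing mM.
    by have := weight_gt0 (R:=R) e m.+1; lra.
  have rm : r n < 2 * w m.
    by rewrite ltNge; apply/negP => /mmin; rewrite ltnn.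
  apply: (@le_trans _ _ (eps * 2 ^- m.+1)%:E).
    rewrite lee_fin (le_trans _ (HM _ Mm))// ge0_ler_powR ?nnegrE ?mulr_ge0//; try lra.
  by rewrite EFinM lee_pmul2l//; exact: spread_measure_ball.
have mB n : measurable (closed_ball (x n) (r n)) by exact: measurable_closed_ball.
apply: (@le_trans _ _ (\esum_(n in D) (eps%:E * nu (closed_ball (x n) (r n))))%E).
  exact: le_esum.
have -> : D = [set n | n \in D] by apply/seteqP; split => n /=; rewrite inE.
rewrite -nneseries_esum; last by move=> n _; rewrite mule_ge0// lee_fin ltW.
rewrite nneseriesZl; last by move=> n _.
rewrite -[leRHS]mule1 lee_pmul2l//.
rewrite -measure_bigcup// -(spread_measureT e_incr).
by apply: le_measure; rewrite ?inE//; exact: bigcup_measurable.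
Qed.

Lemma packing_pre_set0 t : packing_pre t (set0 : set R) = 0%E.
Proof.
apply/eqP; rewrite eq_le packing_pre_ge0 andbT.
apply: (@le_trans _ _ (packing_pre_delta t 1 (set0 : set R))).
  by apply: ereal_inf_lbound; exists 1 => //=.
apply: ge_ereal_sup => _ [D [x [r [[pD tD] ->]]]].
rewrite (_ : D = set0) ?esum_set0//.
by apply/seteqP; split => // n /pD[].
Qed.

Lemma dimP_carrier_le (s : R) : 0 < s ->
  (forall t, s < t -> forall eps : R, 0 < eps -> exists M, forall m, (M <= m)%N ->
    (4 * w m) `^ t <= eps * 2 ^- m.+1) ->
  (dimP carrier <= s%:E)%E.
Proof.
move=> s0 Hs; apply/lee_addgt0Pr => eps eps0; rewrite -EFinD.
have se : s < s + eps by rewrite ltrDl.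
have se0 : 0 <= s + eps by rewrite ltW// (lt_trans s0).
apply: ereal_inf_lbound; exists (s + eps) => //; split => //.
apply/eqP; rewrite eq_le; apply/andP; split; last first.
  apply: le_ereal_inf_tmp => _ [F _ <-].
  by apply: nneseries_ge0 => n _ _; exact: packing_pre_ge0.
apply: ereal_inf_lbound; exists (fun n => if n is 0%N then carrier else set0).
  by move=> y Ky; exists 0%N.
apply: eseries0 => -[|n] _ _; last exact: packing_pre_set0.
by apply: packing_pre_carrier => //; exact: Hs.
Qed.

End upper_dimension.

(** * The constant random measure *)

Section constant_kernel.
Context d d' (X : measurableType d) (Y : measurableType d') (R : realType).
Variable nu : {measure set Y -> \bar R}.

Definition constant_kernel (x : X) : {measure set Y -> \bar R} := nu.

Let measurable_constant_kernel U : measurable U ->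
  measurable_fun [set: X] (constant_kernel ^~ U).
Proof. by move=> _; exact: measurable_cst. Qed.

HB.instance Definition _ :=
  isKernel.Build _ _ _ _ _ constant_kernel measurable_constant_kernel.

End constant_kernel.

Lemma bernoulli_dirac (R : realType) :
  bernoulli_measure
    (@dirac _ (OmegaF R) (fun=> exist _ 1%N isT) R : probability _ _).
Proof.
pose p (j : nat) : R := (j == 1%N)%:R; exists p; split.
  split=> [j _|]; first by rewrite /p ler0n.
  apply/cvg_lim => //; apply: cvg_near_cst; exists 2%N => // n /= n2.
  rewrite big_ltn// big_nat big1 ?adde0// => j /andP[j2 _].
  by rewrite /p; case: j j2 => [//|[]].
move=> u; rewrite /= diracE; congr EFin.
have -> : \prod_(a <- u) p (val a) = (all (fun a : posnat => val a == 1%N) u)%:R.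
  elim: u => [|a u IH]; first by rewrite big_nil.
  by rewrite big_cons IH /p -natrM mulnb.
congr (_%:R); congr nat_of_bool; apply/idP/idP.
  rewrite inE => H; apply/(all_nthP (exist _ 1%N isT)) => i ilt.
  by have := H (Ordinal ilt); rewrite (tnth_nth (exist _ 1%N isT))/= => <-.
move=> /(all_nthP (exist _ 1%N isT)) H; rewrite inE => i.
rewrite (tnth_nth (exist _ 1%N isT))/=.
by apply/val_inj => /=; apply/esym/eqP; exact: H.
Qed.

Theorem theorem1p8 (R : realType) (s : R) (s_gt0 : 0 < s) (s_le1 : s <= 1) :
  exists (mu : R.-ker OmegaF R ~> R) (P : probability (OmegaF R) R),
    spectral_random_measure mu /\ bernoulli_measure P /\
    {ae P, forall w, dimH_measure (mu w) = s%:E /\ dimP_measure (mu w) = s%:E}.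
Proof.
have e_incr := place_incr s_gt0 s_le1.
pose nu := @spread_measure R (place s) e_incr.
have lowerH E : measurable E -> (0 < nu E)%E -> (s%:E <= dimH E)%E.
  by apply: dimH_ge_spread => t; exact: weight_place_lower.
have upperP : (dimP (carrier (place s) : set R) <= s%:E)%E.
  by apply: dimP_carrier_le => // t; exact: weight_place_upper.
have carrier_pos : measurable (carrier (place s) : set R) /\ (0 < nu (carrier (place s)))%E.
  by split; [exact: measurable_carrier|rewrite spread_measure_carrier].
exists (constant_kernel nu), (@dirac _ (OmegaF R) (fun=> exist _ 1%N isT) R).
split; first by move=> w; apply: spectral_spread_measure; exact: place_gap.
split; first exact: bernoulli_dirac.
apply/nearW => w; split; apply/eqP; rewrite eq_le; apply/andP; split.
- apply: (le_trans _ (le_trans (dimH_le_dimP _) upperP)).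
  by apply: ereal_inf_lbound; exists (carrier (place s)).
- by apply: le_ereal_inf_tmp => _ [E [mE E0] <-]; exact: lowerH.
- apply: le_trans upperP.
  by apply: ereal_inf_lbound; exists (carrier (place s)).
- apply: le_ereal_inf_tmp => _ [E [mE E0] <-].
  exact: le_trans (lowerH _ mE E0) (dimH_le_dimP E).
Qed.
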